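(* (i) If $\langle\Delta t\rangle<\infty$, then the infinite time limit $\mathbf P(\infty)=\lim_{t\to\infty}\mathbf P(t)$ of the propagator is $$\mathbf P(\infty)=\mathbf R\,\bar f(\infty,\mathbf W),\qquad \bar f(\infty,\mathbf W)=\frac1{\langle\Delta t\rangle}\sum_{b=0}^\infty\Phi^{(0)}(b)\,\mathbf W^b,$$ that is, for all $i,j$, $$P_{ij}(\infty)=\frac{K_j}{\sum_{r=1}^NK_r}+\frac1{\langle\Delta t\rangle}\sum_{m=2}^N\frac{1-\bar\psi(\lambda_m)}{1-\lambda_m}\sum_{r=1}^NR_r\,\langle r|\phi_m\rangle\langle\bar\phi_m|j\rangle ,$$ which does not depend on the starting node $i$ (the matrix $\mathbf P(\infty)$ has identical rows). Further, $\mathbf P(\infty)$ preserves row normalization, satisfies $\mathbf P(\infty)=\mathbf R\,\mathbf P(\infty)$, and has rank one, with a single eigenvalue equal to one and $N-1$ zero eigenvalues. (ii) If $\langle\Delta t\rangle=\infty$, then the second term is suppressed and the stationary (equilibrium) distribution of the walk without resets is taken for infinite times: $\lim_{t\to\infty}P_{ij}(t)=K_j/\sum_{r=1}^NK_r$ for all $i,j$. Thus a non-equilibrium steady state (a limit with non-vanishing second term) requires a finite mean $\langle\Delta t\rangle$.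
   Context: Let $\mathbf A=(A_{ij})$ be the $0/1$ symmetric adjacency matrix, with $A_{ii}=0$, of a finite connected undirected non-bipartite graph on nodes $1,\dots,N$; let $K_i=\sum_jA_{ij}$ and $\mathbf W=(W_{ij})$, $W_{ij}=A_{ij}/K_i$. Then $\mathbf W$ is diagonalizable with real eigenvalues $\lambda_1=1$ (simple) and $|\lambda_m|<1$ for $m=2,\dots,N$. Let $|\phi_m\rangle$ (columns) and $\langle\bar\phi_m|$ (rows) be right and left eigenvectors with $\langle\bar\phi_m|\phi_n\rangle=\delta_{mn}$ and $\sum_m|\phi_m\rangle\langle\bar\phi_m|=\mathbf 1$; $\langle i|\phi_m\rangle$ and $\langle\bar\phi_m|j\rangle$ are their $i$-th and $j$-th components. Let $\mathbf R$ be the $N\times N$ matrix with identical rows, $R_{ij}=R_j$, where $R_j\ge0$ and $\sum_jR_j=1$ (relocation matrix). Let $\Delta t_1,\Delta t_2,\dots$ be i.i.d. copies of a random variable $\Delta t$ with values in $\{1,2,\dots\}$ and law $\psi(r)=\mathbb P[\Delta t=r]$, with generating function $\bar\psi(u)=\sum_{r\ge1}\psi(r)u^r$ and mean $\langle\Delta t\rangle\in[1,\infty]$. Put $J_0=0$, $J_n=\Delta t_1+\dots+\Delta t_n$, $\Phi^{(0)}(t)=\sum_{r>t}\psi(r)$, and $\Theta(J_n,t,J_{n+1})=1$ if $J_n\le t\le J_{n+1}-1$ and $0$ otherwise; $\langle\cdot\rangle$ denotes expectation. The propagator of the walk with resets is $$\mathbf P(t)=\mathbf W^t\,\langle\Theta(J_0,t,J_1)\rangle+\mathbf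 R\sum_{n=1}^\infty\bigl\langle\Theta(J_n,t,J_{n+1})\,\mathbf W^{t-J_n}\bigr\rangle,\qquad t\in\mathbb N_0 .$$
   Formalization: In (i), convergence of P(t) is claimed only if the support of ψ has gcd 1 (for Δt=2 a.s. on a triangle with R concentrated on one node, P(t) oscillates); without it, any limit of P(t) that exists is shown to equal P(∞), and the other claims are unconditional. *)

(* Defs.v *)
From HB Require Import structures.
From mathcomp Require Import all_boot all_order all_algebra.
From mathcomp Require Import all_classical all_reals all_analysis.
Import Order.TTheory GRing.Theory Num.Theory numFieldNormedType.Exports.

Set Implicit Arguments.
Unset Strict Implicit.
Unset Printing Implicit Defensive.

Local Open Scope classical_set_scope.
Local Open Scope ring_scope.

Section Graph.
Context (R : realType) (N : nat).
Implicit Type e : rel 'I_N.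

Definition simple_graph e := symmetric e /\ irreflexive e.

Definition connected_graph e := forall i j : 'I_N, connect e i j.

Definition bipartite_graph e :=
  exists c : 'I_N -> bool, forall i j, e i j -> c i != c j.

Definition adj_mx e : 'M[R]_N := \matrix_(i, j) (e i j)%:R.

Definition degree e (i : 'I_N) : R := \sum_j adj_mx e i j.

Definition transition_mx e : 'M[R]_N :=
  \matrix_(i, j) (adj_mx e i j / degree e i).

Definition equilibrium_mx e : 'M[R]_N :=
  \matrix_(i, j) (degree e j / \sum_r degree e r).

(* Column [m] of [phi] is the ket |phi_m>, row [m] of [phibar] is the bra
   <phibar_m|.  Indices start at 0, so [lam] takes the value 1 at index 0.
   That 1 is a simple eigenvalue and that the others have modulus < 1 is not
   assumed: it follows from connectedness and non-bipartiteness. *)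
Definition eigensystem (W : 'M[R]_N) (lam : 'I_N -> R) (phi phibar : 'M[R]_N) :=
  [/\ forall m, W *m col m phi = lam m *: col m phi,
      forall m, row m phibar *m W = lam m *: row m phibar,
      forall m n, row m phibar *m col n phi = (m == n)%:R%:M,
      \sum_m col m phi *m row m phibar = 1%:M &
      forall m : 'I_N, m = 0%N :> nat -> lam m = 1].

Definition distribution_vector (rho : 'I_N -> R) :=
  (forall j, 0 <= rho j) /\ \sum_j rho j = 1.

Definition relocation_mx (rho : 'I_N -> R) : 'M[R]_N := \matrix_(i, j) rho j.

End Graph.

Section Probability.
Context (R : realType) (d : measure_display) (Omega : measurableType d)
  (P : probability Omega R).

Definition mutually_independent d' (T : measurableType d')
    (X : nat -> {RV P >-> T}) :=
  forall (s : seq nat) (A : nat -> set T), uniq s ->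
    (forall n, measurable (A n)) ->
    P (\bigcap_(n in [set` s]) (X n @^-1` A n)) =
    (\prod_(n <- s) P (X n @^-1` A n))%E.

Definition identically_distributed d' (T : measurableType d')
    (X : nat -> {RV P >-> T}) :=
  forall n (A : set T), measurable A ->
    distribution P (X n) A = distribution P (X 0%N) A.

Definition real_expectation (Y : Omega -> R) : R := fine 'E_P[Y]%E.

Definition mean_time (X : {RV P >-> nat}) : \bar R := 'E_P[fun w => (X w)%:R]%E.

Definition law (X : {RV P >-> nat}) (r : nat) : R :=
  fine (distribution P X [set r]).

Definition gen_fun (X : {RV P >-> nat}) (u : R) : R :=
  (\big[+%R/0]_(1 <= r <oo) (law X r * u ^+ r))%BIG.

Definition survival (X : {RV P >-> nat}) (t : nat) : R :=
  (\big[+%R/0]_(t.+1 <= r <oo) law X r)%BIG.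

(* The support of the law has greatest common divisor 1.  When the mean is
   finite, convergence of the propagator may fail without this condition: for
   waiting times constantly equal to 2 the propagator is Rel at positive even
   times and Rel *m W at odd times. *)
Definition aperiodic (X : {RV P >-> nat}) :=
  forall k : nat, (forall r, law X r != 0 -> (k %| r)%N) -> k = 1%N.

End Probability.

Section Walk.
Context (R : realType) (d : measure_display) (Omega : measurableType d)
  (P : probability Omega R) (N : nat).
(* [dt k] is the (k+1)-st waiting time. *)
Implicit Types (dt : nat -> {RV P >-> nat}) (W Rel : 'M[R]_N).

Definition reset_time dt (n : nat) (w : Omega) : nat := (\sum_(k < n) dt k w)%N.

Definition Theta (a t b : nat) : R := (a <= t < b)%:R.

(* Entrywise expectation of Theta(J_n, t, J_{n+1}) W^(t - J_n); the truncated
   subtraction is harmless because Theta vanishes when t < J_n. *)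
Definition reset_term dt W (t n : nat) : 'M[R]_N :=
  \matrix_(i, j) real_expectation P (fun w =>
    Theta (reset_time dt n w) t (reset_time dt n.+1 w) *
    (W ^+ (t - reset_time dt n w)) i j).

Definition propagator dt W Rel (t : nat) : 'M[R]_N :=
  real_expectation P (fun w => Theta (reset_time dt 0 w) t (reset_time dt 1 w))
    *: W ^+ t
  + Rel *m (\big[+%R/0]_(1 <= n <oo) reset_term dt W t n)%BIG.

Definition fbar_series dt W : nat -> 'M[R]_N :=
  series (fun b => survival (dt 0%N) b *: W ^+ b).

Definition fbar dt W : 'M[R]_N :=
  (fine (mean_time (dt 0%N)))^-1 *: limn (fbar_series dt W).

Definition limit_propagator dt W Rel : 'M[R]_N := Rel *m fbar dt W.

End Walk.

(* Main.v *)
Require Import Defs.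
From HB Require Import structures.
From mathcomp Require Import all_boot all_order all_algebra.
From mathcomp Require Import all_classical all_reals all_analysis.
From mathcomp Require Import measurable_realfun.
From mathcomp Require Import ring lra zify.
Import Order.TTheory GRing.Theory Num.Theory numFieldNormedType.Exports.

Set Implicit Arguments.
Unset Strict Implicit.
Unset Printing Implicit Defensive.

Local Open Scope classical_set_scope.
Local Open Scope ring_scope.

(* Independence turns the expectations into convolutions: if u is the renewal
   mass (u_k is the sum over n of P(J_n = k)), Phi the tail of the waiting time
   and y_j(b) = sum_l R_l (W^b)_lj, then
     P_ij(t) = Phi(t) ((W^t)_ij - y_j(t)) + (u * (Phi y_j))(t),
   with u * Phi = 1.  The first summand tends to 0.  For a finite mean mu the
   Erdos-Feller-Pollard renewal theorem gives u -> 1/mu in the aperiodic case,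
   and dominated convergence gives the limit; without aperiodicity, a limit of
   the propagator is identified by convolving with Phi once more, since
   Phi * u * a is the sequence of partial sums of a.  For mu infinite, u -> 0,
   so that the convolution only sees large b, where y_j(b) is close to the
   equilibrium.  The graph being connected and not bipartite, some power of W
   is positive and contracts the l1 norm on zero-sum vectors, whence W^b
   converges to the equilibrium; the same limit applied to eigenvectors shows
   that 1 is a simple eigenvalue and identifies its spectral projection. *)

(** * Renewal sequences *)

Section Convolution.
Context (R : comNzRingType).
Implicit Types a b c : nat -> R.

Definition convol a b (t : nat) : R := \sum_(k < t.+1) a k * b (t - k)%N.

(** Up to degree [t], convolution is the product of truncated polynomials, so its commutativity and
    associativity come from the ring [{poly R}]. *)
Lemma convol_poly a b n t : (t < n)%N ->
  convol a b t = ((\poly_(i < n) a i) * (\poly_(i < n) b i))`_t.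
Proof.
move=> tn; rewrite coefM; apply: eq_bigr => k _; rewrite !coef_poly.
by rewrite (leq_trans (ltn_ord k)) // (leq_ltn_trans (leq_subr _ _)).
Qed.

Lemma convolC a b t : convol a b t = convol b a t.
Proof. by rewrite !(@convol_poly _ _ t.+1) // mulrC. Qed.

Lemma convolA a b c t : convol (convol a b) c t = convol a (convol b c) t.
Proof.
pose P x : {poly R} := \poly_(i < t.+1) x i.
transitivity ((P a * P b * P c)`_t).
  rewrite coefM; apply: eq_bigr => k _; rewrite (@convol_poly _ _ t.+1) //.
  by rewrite coef_poly ltnS leq_subr.
rewrite -mulrA coefM; apply: eq_bigr => k _.
by rewrite (@convol_poly b c t.+1) ?ltnS ?leq_subr // coef_poly ltn_ord.
Qed.

End Convolution.

(** * Semigroups of integers with greatest common divisor 1 *)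

Section NumericalSemigroup.
Local Open Scope nat_scope.

(* The shifts [T] preserving [G] form a semigroup containing [S].  The least
   positive difference of two elements of [T] divides all of [S], so it is 1;
   from [b] and [b + 1] in [T] one reaches every integer beyond [b * b]. *)
Lemma shift_closed_eventually (G S : nat -> Prop) :
  G 0 -> (forall s r, G s -> S r -> G (s + r)) ->
  (forall k, (forall r, S r -> k %| r) -> k = 1) ->
  exists s0, forall s, s0 <= s -> G s.
Proof.
move=> G0 GS Sgcd.
pose T s := forall g, G g -> G (g + s).
have TG s : T s -> G s by move=> /(_ 0 G0).
have T0 : T 0 by move=> g; rewrite addn0.
have TD s r : T s -> T r -> T (s + r).
  by move=> Ts Tr g Gg; rewrite addnA; apply/Tr/Ts.
have TM k s : T s -> T (k * s).
  by move=> Ts; elim: k => [|k IH]; rewrite ?mul0n // mulSn; apply: TD.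
have ST s : S s -> T s by move=> Ss g Gg; apply: GS.
pose D d := 0 < d /\ exists b, T b /\ T (b + d).
have [d0 Dd0] : exists d, `[< D d >].
  (* Without any positive difference [S] would contain at most 0, and then 0 would divide all of
     it. *)
  apply: contrapT => noD; suff: 0 = 1 by [].
  apply: Sgcd => r Sr; rewrite dvd0n; apply: contrapT => /negP r0.
  by apply: noD; exists r; apply/asboolP; split; [rewrite lt0n | exists 0; split => //; apply: ST].
have /ex_minnP[g /asboolP[g0 [b [Tb Tbg]]] gmin] : exists d, `[< D d >] by exists d0.
have g1 : g = 1.
  apply: Sgcd => r /ST Tr; rewrite /dvdn -leqn0 leqNgt; apply/negP => rg0.
  have := gmin (r %% g); rewrite leqNgt ltn_mod g0 => /(_ _)/negP; apply => //.
  (* With q = [r %/ g], the elements q(b + g) and qb + r of [T] differ by [r %% g], a positive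
     difference below the minimal one. *)
  apply/asboolP; split => //; exists (r %/ g * (b + g)); split; first exact: TM.
  rewrite mulnDr -addnA -divn_eq addnC; apply: TD => //; exact: TM.
exists (b * b) => s bs; apply: TG.
have [b0|b0] := posnP b.
  by rewrite b0 g1 in Tbg; rewrite -[s]muln1; apply: TM.
(* As [b * b <= s], the quotient is at least [b], hence above the remainder, and the truncated
   subtraction is exact. *)
have -> : s = (s %/ b - s %% b) * b + s %% b * (b + 1).
  rewrite mulnBl {1}(divn_eq s b) mulnDr muln1.
  have : s %% b * b <= s %/ b * b.
    rewrite leq_mul2r; apply/orP; right; apply: (@leq_trans b).
      by rewrite ltnW // ltn_mod.
    by rewrite leq_divRL.
  lia.
by apply: TD; apply: TM => //; rewrite -g1.
Qed.

End NumericalSemigroup.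

(** * Dominated convergence for sums, and upper limits *)

Section Limits.
Context (R : realType).
Implicit Types (v a g h : nat -> R).

Lemma cvg_sum (T I : Type) (F : set_system T) (FF : Filter F) (r : seq I)
    (Q : pred I) (f : I -> T -> R) (l : I -> R) :
  (forall i, f i x @[x --> F] --> l i) ->
  \sum_(i <- r | Q i) f i x @[x --> F] --> \sum_(i <- r | Q i) l i.
Proof. by move=> fl; apply: cvg_big => // x; exact: add_continuous. Qed.

Lemma series_le_lim g n (gl : R) : (forall b, 0 <= g b) ->
  series g @ \oo --> gl -> series g n <= gl.
Proof.
move=> g0 gc; have <- : limn (series g) = gl by exact: cvg_lim.
apply: nondecreasing_cvgn_le; last by apply/cvg_ex; exists gl.
by apply: nondecreasing_series => k _ _; exact: g0.
Qed.

Lemma sum_nat_le_lim g m n (gl : R) : (forall b, 0 <= g b) ->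
  series g @ \oo --> gl -> (m <= n)%N ->
  \sum_(m <= b < n) g b <= gl - series g m.
Proof.
move=> g0 gc mn; rewrite -sub_series_geq // lerD2r.
exact: series_le_lim.
Qed.

Lemma dominated_series_cvg g h (gl : R) :
  (forall b, `|h b| <= g b) -> series g @ \oo --> gl -> cvgn (series h).
Proof.
move=> hg gc; apply: normed_cvg.
apply: series_le_cvg (hg) _ => // [b|]; first exact: le_trans (hg b).
by apply/cvg_ex; exists gl.
Qed.

(** Tannery's theorem for sums whose length [K j] tends to infinity: beyond some [B] the majorant
    [g] makes all sums uniformly small, and the first [B] terms converge one by one. *)
Lemma tannery (f : nat -> nat -> R) g h (K : nat -> nat) (gl : R) :
  (forall M : nat, \forall j \near \oo, (M <= K j)%N) ->
  (forall j b, `|f j b| <= g b) -> series g @ \oo --> gl ->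
  (forall b, f j b @[j --> \oo] --> h b) ->
  \sum_(0 <= b < K j) f j b @[j --> \oo] --> limn (series h).
Proof.
move=> Koo fg gc fh.
have g0 b : 0 <= g b by exact: le_trans (fg 0%N b).
have hg b : `|h b| <= g b.
  have /cvg_norm fhn := fh b.
  rewrite -(cvg_lim (@Rhausdorff R) fhn); apply: limr_le.
    by apply/cvg_ex; eexists; exact: fhn.
  by near=> j; exact: fg.
have hc := dominated_series_cvg hg gc.
apply/cvgrPdist_le => e e0.
have e3 : 0 < e / 3 by rewrite divr_gt0.
have [B [gB hB]] : exists B : nat,
    gl - series g B <= e / 3 /\ `|limn (series h) - series h B| <= e / 3.
  have /cvgrPdist_le/(_ _ e3) gn := gc.
  have /cvgrPdist_le/(_ _ e3) hn := hc.
  near \oo => B; exists B; split; last by near: B; exact: hn.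
  by apply: le_trans (ler_norm _) _; near: B; exact: gn.
have fB : series (f j) B @[j --> \oo] --> series h B.
  by apply: cvg_sum => b; exact: fh.
have /cvgrPdist_le/(_ _ e3) fBn := fB.
near=> j.
have BK : (B <= K j)%N by near: j; exact: Koo.
rewrite (big_cat_nat _ BK) //=.
rewrite (_ : _ - _ = (limn (series h) - series h B) + (series h B - series (f j) B)
  - \sum_(B <= b < K j) f j b); last by rewrite /series /=; lra.
apply: (le_trans (ler_normB _ _)).
have -> : e = e / 3 + e / 3 + e / 3 by field.
apply: lerD; last first.
  apply: (le_trans (ler_norm_sum _ _ _)).
  apply: le_trans gB; apply: le_trans (sum_nat_le_lim g0 gc BK).
  by apply: ler_sum => b _; exact: fg.
apply: (le_trans (ler_normD _ _)); apply: lerD => //.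
by near: j; exact: fBn.
Unshelve. all: by end_near. Qed.

(** The number [l] is the upper limit, obtained as the supremum of the [x] that [v] reaches at
    arbitrarily large indices; [n_] realizes it. *)
Lemma limsup_attained v (C : R) : (forall n, `|v n| <= C) ->
  exists (l : R) (n_ : nat -> nat), [/\
    forall e, 0 < e -> \forall n \near \oo, v n < l + e,
    forall j, (j <= n_ j)%N & v (n_ j) @[j --> \oo] --> l].
Proof.
move=> vC.
pose E := [set x | forall N, exists2 n, (N <= n)%N & x <= v n].
have supE : has_sup E.
  split.
    by exists (- C) => N; exists N => //; have := vC N; rewrite ler_norml => /andP[].
  exists C => x /(_ 0%N)[n _ xv]; apply: (le_trans xv).
  by have := vC n; rewrite ler_norml => /andP[].
have up e : 0 < e -> \forall n \near \oo, v n < sup E + e.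
  move=> e0; apply: contrapT => nup.
  have : E (sup E + e).
    move=> N; apply: contrapT => noN; apply: nup; exists N => // n Nn /=.
    by rewrite ltNge; apply/negP => le; apply: noN; exists n.
  by move=> /(ub_le_sup supE.2); rewrite leNgt ltrDl e0.
have dn e N : 0 < e -> exists2 n, (N <= n)%N & sup E - e < v n.
  move=> e0; have [x Ex xe] := sup_adherent e0 supE.
  by have [n Nn xv] := Ex N; exists n => //; exact: lt_le_trans xv.
have /choice[n_ n_P] (j : nat) : exists n, (j <= n)%N /\ sup E - j.+1%:R^-1 < v n.
  by have [n ? ?] := dn j.+1%:R^-1 j ltac:(by rewrite invr_gt0); exists n.
exists (sup E), n_; split => //; first by move=> j; case: (n_P j).
apply/cvgrPdist_lt => e e0.
have [N _ NP] := up e e0.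
near=> j.
have [jn lo] := n_P j.
have hi : v (n_ j) < sup E + e.
  by apply: NP; apply: leq_trans jn; near: j; exact: nbhs_infty_ge.
have je : j.+1%:R^-1 < e.
  near: j; have /cvgrPdist_lt/(_ _ e0) := @cvg_harmonic R.
  apply: filterS => j; rewrite /= sub0r normrN ger0_norm //.
by rewrite distrC ltr_distl; rewrite hi andbT; apply: lt_trans lo; rewrite ltrD2l ltrN2.
Unshelve. all: by end_near. Qed.

End Limits.

(** * The renewal equation and the limit of its solution *)

Section Renewal.
Context (R : realType) (p u : nat -> R).
Context (p_ge0 : forall r, 0 <= p r) (p0 : p 0%N = 0)
  (p_sum : series p @ \oo --> (1 : R)).
Context (u_ge0 : forall t, 0 <= u t)
  (uE : forall t, u t = (t == 0%N)%:R + convol p u t).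

(** As [p] sums to 1, this is the mass of [p] beyond [t], written with a finite sum. *)
Definition tail t := 1 - series p t.+1.

Lemma tail0 : tail 0 = 1.
Proof. by rewrite /tail /series /= big_nat1 p0 subr0. Qed.

Lemma tailS t : tail t.+1 = tail t - p t.+1.
Proof. by rewrite /tail /series /= [in LHS]big_nat_recr //= opprD addrA. Qed.

Lemma tail_ge0 t : 0 <= tail t.
Proof. by rewrite subr_ge0; exact: series_le_lim. Qed.

Lemma tail_nonincreasing s t : (s <= t)%N -> tail t <= tail s.
Proof.
move=> /subnK <-; elim: (t - s)%N => // k IH.
by rewrite addSn tailS (le_trans _ IH) // lerBlDr lerDl.
Qed.

Lemma tail_cvg0 : tail @ \oo --> (0 : R).
Proof.
rewrite -(subrr (1 : R)); apply: cvgB; first exact: cvg_cst.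
by rewrite (cvg_shiftS (series p)).
Qed.

(** Exactly one renewal is the last one up to time [t]. Algebraically, the renewal equation for the
    leading term [u t.+1] supplies the masses [p] that turn each [tail k.+1] back into [tail k]. *)
Lemma convol_tail t : convol tail u t = 1.
Proof.
elim: t => [|t IH].
  by rewrite /convol big_ord1 tail0 uE eqxx /convol big_ord1 p0 mul0r addr0 mulr1.
rewrite /convol big_ord_recl tail0 mul1r subn0 uE /= add0r.
rewrite /convol big_ord_recl p0 mul0r add0r -big_split /= -[RHS]IH.
apply: eq_bigr => k _; rewrite /bump /= add1n subSS tailS.
by rewrite -mulrDl addrC subrK.
Qed.

Lemma u_le1 t : u t <= 1.
Proof.
rewrite -(convol_tail t) /convol big_ord_recl tail0 mul1r subn0 lerDl.
by apply: sumr_ge0 => k _; rewrite mulr_ge0 ?tail_ge0.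
Qed.

(* If [v m] is close to the upper limit [l] of [v], then, [v m] being an average
   of the earlier values with weights [p], every value entering with positive
   weight is close to [l] as well. *)
Lemma limsup_shift (v : nat -> R) (C l : R) (m : nat -> nat) (r : nat) :
  (forall n, `|v n| <= C) ->
  (forall n, (0 < n)%N -> v n = convol p v n) ->
  (forall e, 0 < e -> \forall n \near \oo, v n < l + e) ->
  (forall M : nat, \forall j \near \oo, (M <= m j)%N) ->
  v (m j) @[j --> \oo] --> l -> 0 < p r ->
  v (m j - r)%N @[j --> \oo] --> l.
Proof.
move=> vC vp limsup moo vm pr.
pose D := C + `|l|.
have vD n : v n - l <= D.
  by apply: le_trans (ler_norm _) _; apply: le_trans (ler_normB _ _) _; exact: lerD.
apply/cvgrPdist_le => e e0.
(* Four errors of size [del] will occur: from [v (m j)] against [l], from the excess of late values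
   over [l], from the early values, and from the mass of [p] beyond [m j]. *)
pose del := e * p r / 4.
have del0 : 0 < del by rewrite divr_gt0 // mulr_gt0.
have [N _ NP] := limsup _ del0.
have tailm (c : R) (k : nat) : c * tail (m j - k)%N @[j --> \oo] --> (0 : R).
  rewrite -[X in _ --> X](mulr0 c); apply: cvgM; first exact: cvg_cst.
  apply: (cvg_comp _ _ _ tail_cvg0).
  move=> A [M _ MA]; apply: filterS (moo (M + k)%N) => j Mj.
  by apply: MA => /=; rewrite leq_subRL // ?(leq_trans _ Mj) ?leq_addl // addnC.
have := tailm D N => /cvgrPdist_le/(_ _ del0) tD.
have := tailm `|l| 0%N => /cvgrPdist_le/(_ _ del0) tl.
have := vm => /cvgrPdist_le/(_ _ del0) vml.
near=> j.
have mj : (N + r < m j)%N by near: j; exact: moo.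
have tD' : D * tail (m j - N) <= del.
  by apply: le_trans (ler_norm _) _; rewrite -normrN -sub0r; near: j; exact: tD.
have tl' : `|l| * tail (m j) <= del.
  rewrite -[m j]subn0.
  by apply: le_trans (ler_norm _) _; rewrite -normrN -sub0r; near: j; exact: tl.
have vml' : l - v (m j) <= del.
  by apply: le_trans (ler_norm _) _; near: j; exact: vml.
have hi : v (m j - r)%N < l + del by apply: NP => /=; lia.
have del_e : del <= e.
  have : p r <= 1.
    have := tail_ge0 r; have := series_le_lim r p_ge0 p_sum.
    have : 0 <= series p r by apply: sumr_ge0.
    rewrite /tail /series /= big_nat_recr //=; lra.
  rewrite /del; nra.
suff lo : p r * (l - v (m j - r)%N) <= p r * e.
  rewrite ler_pM2l // in lo.
  by rewrite ler_norml lo andbT; lra.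
move: (m j) mj tD' tl' vml' hi => M NrM tDM tlM vlM hi.
have vM : v M - l = series (fun k => p k * (v (M - k)%N - l)) M.+1 - l * tail M.
  rewrite vp; last lia.
  rewrite /convol /series /= -(big_mkord xpredT (fun k => p k * v (M - k)%N)).
  under [in RHS]eq_bigr do rewrite mulrBr.
  rewrite sumrB -mulr_suml /tail /series /=; ring.
(* The index [r] is isolated. For the other [k <= M - N] the value [v (M - k)] is below [l + del];
   for [k > M - N] only the bound [D] is known, but these weights sum to at most [tail (M - N)]. *)
have split : series (fun k => p k * (v (M - k)%N - l)) M.+1 <=
    p r * (v (M - r)%N - l) + del + D * tail (M - N).
  rewrite /series /= (@big_cat_nat _ _ _ (M - N).+1) //=; last lia.
  apply: lerD; last first.
    rewrite (le_trans (y := \sum_((M - N).+1 <= k < M.+1) p k * D)) //.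
      by apply: ler_sum => k _; apply: ler_wpM2l.
    rewrite -mulr_suml mulrC; apply: ler_wpM2l.
      by rewrite addr_ge0 // ?(le_trans _ (vC 0%N)).
    by apply: sum_nat_le_lim => //; lia.
  rewrite (bigD1_seq r) ?iota_uniq ?mem_index_iota //=; last by clear -NrM; lia.
  rewrite lerD2l; apply: (@le_trans _ _ (series p (M - N).+1 * del)).
    rewrite /series /= mulr_suml [leRHS](bigID (fun k => k != r)) /=.
    rewrite ler_wpDr //; first by apply: sumr_ge0 => k _; rewrite mulr_ge0 // ltW.
    rewrite big_nat_cond [leRHS]big_nat_cond.
    apply: ler_sum => k /andP[/andP[_ kM] _]; apply: ler_wpM2l => //.
    by rewrite lerBlDl ltW //; apply: NP => /=; lia.
  rewrite ger_pMl //; exact: series_le_lim.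
have : l * tail M <= del.
  by apply: le_trans tlM; rewrite ler_wpM2r ?tail_ge0 ?ler_norm.
have : - (l * tail M) <= del.
  apply: le_trans tlM; rewrite -mulNr; apply: ler_wpM2r; first exact: tail_ge0.
  by rewrite -normrN ler_norm.
have : p r * e = 4 * del by rewrite /del; field.
lra.
Unshelve. all: by end_near. Qed.

(* Along [n_], [v (n_ j - s)] tends to [l] for every large [s], and one passes to
   the limit in [tail * v = c]. *)
Lemma limsup_renewal (v : nat -> R) (C c l mu : R) (n_ : nat -> nat) :
  (forall k : nat, (forall r, p r != 0 -> (k %| r)%N) -> k = 1%N) ->
  series tail @ \oo --> mu ->
  (forall n, `|v n| <= C) ->
  (forall n, (0 < n)%N -> v n = convol p v n) ->
  (forall n, convol tail v n = c) ->
  (forall e, 0 < e -> \forall n \near \oo, v n < l + e) ->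
  (forall j, (j <= n_ j)%N) -> v (n_ j) @[j --> \oo] --> l ->
  c = mu * l.
Proof.
move=> aper tmu vC vp vc limsup nj vl.
have noo (s M : nat) : \forall j \near \oo, (M <= n_ j - s)%N.
  near=> j; rewrite leq_subRL; last first.
    by apply: leq_trans (nj j); near: j; exact: nbhs_infty_ge.
  by apply: leq_trans (nj j); near: j; exact: nbhs_infty_ge.
have [s0 Gs0] : exists s0, forall s, (s0 <= s)%N -> v (n_ j - s)%N @[j --> \oo] --> l.
  apply: (@shift_closed_eventually _ (fun r => p r != 0)) => //.
    by under eq_cvg do rewrite subn0.
  move=> s r vs pr; under eq_cvg do rewrite subnDA.
  apply: (limsup_shift vC vp limsup (noo s) vs).
  by rewrite lt_neqAle eq_sym pr p_ge0.
have C0 : 0 <= C by exact: le_trans (normr_ge0 _) (vC 0%N).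
have := @tannery _ (fun j b => tail b * v (n_ j - (s0 + b))%N) (fun b => C * tail b)
  (fun b => tail b * l) (fun j => (n_ j - s0).+1) (C * mu).
have Ctail : series (fun b => C * tail b) = (fun n => C * series tail n).
  by apply/funext => n; rewrite /series /= mulr_sumr.
have ltail : series (fun b => tail b * l) = (fun n => series tail n * l).
  by apply/funext => n; rewrite /series /= mulr_suml.
rewrite Ctail ltail => T.
have {}T : c @[j --> \oo] --> limn (fun n => series tail n * l).
  have -> : (fun=> c) = (fun j : nat => \sum_(0 <= b < (n_ j - s0).+1)
      tail b * v (n_ j - (s0 + b))%N).
    apply/funext => j; rewrite -(vc (n_ j - s0)%N) /convol big_mkord.
    by apply: eq_bigr => b _; rewrite subnDA.
  apply: T.
  - move=> M; near=> j; apply: (@leq_trans (n_ j - s0)); last exact: leqnSn.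
    by near: j; exact: noo.
  - by move=> j b; rewrite normrM ger0_norm ?tail_ge0 // mulrC ler_wpM2r ?tail_ge0.
  - by apply: cvgM; first exact: cvg_cst.
  - by move=> b; apply: cvgM; [exact: cvg_cst | apply: Gs0]; exact: leq_addr.
rewrite (cvg_unique (@Rhausdorff R) (cvg_cst c) T).
by apply: cvg_lim => //; apply: cvgM => //; exact: cvg_cst.
Unshelve. all: by end_near. Qed.

Lemma series_tail_ge1 n : 1 <= series tail n.+1.
Proof.
rewrite /series /= big_nat_recl //= tail0 lerDl.
by apply: sumr_ge0 => k _; exact: tail_ge0.
Qed.

(** The sequences [u] and [- u] are treated alike through a sign [s]: [limsup_renewal] with [c = s]
    shows that the upper limit of [s * u] is [s * mu^-1], which bounds [u] asymptotically from both
    sides. *)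
Theorem renewal_theorem (mu : R) :
  (forall k : nat, (forall r, p r != 0 -> (k %| r)%N) -> k = 1%N) ->
  series tail @ \oo --> mu -> u @ \oo --> mu^-1.
Proof.
move=> aper tmu.
have mu0 : 0 < mu.
  apply: lt_le_trans ltr01 _; apply: le_trans (series_tail_ge1 0) _.
  exact: series_le_lim tail_ge0 tmu.
have key (s : R) : `|s| = 1 ->
    forall e, 0 < e -> \forall n \near \oo, s * u n < s * mu^-1 + e.
  move=> s1; have vC n : `|s * u n| <= 1.
    by rewrite normrM s1 mul1r ger0_norm // u_le1.
  have [l [n_ [lsup nj vl]]] := limsup_attained vC.
  have <- // : l = s * mu^-1.
  apply: (mulfI (lt0r_neq0 mu0)); rewrite mulrCA mulfV ?lt0r_neq0 // mulr1.
  symmetry; apply: (limsup_renewal aper tmu vC _ _ lsup nj vl) => n.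
    move=> n0; rewrite uE -[_ == _]negbK -lt0n n0 add0r /convol mulr_sumr.
    by apply: eq_bigr => k _; rewrite mulrCA.
  rewrite -[RHS]mulr1 -(convol_tail n) /convol mulr_sumr.
  by apply: eq_bigr => k _; rewrite mulrCA.
apply/cvgrPdist_lt => e e0.
have hi := key 1 (normr1 _) e e0.
have lo := key (- 1) (normrN1 _) e e0.
near=> n.
have : 1 * u n < 1 * mu^-1 + e by near: n; exact: hi.
have : -1 * u n < -1 * mu^-1 + e by near: n; exact: lo.
rewrite distrC ltr_distl => lo' hi'; apply/andP; split; lra.
Unshelve. all: by end_near. Qed.

(* No aperiodicity is available here: the multiples of a single [r] with
   [0 < p r] suffice, because [sum_i tail (i r)] still diverges. *)
Lemma renewal_null : (forall M, exists n, M <= series tail n) -> u @ \oo --> (0 : R).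
Proof.
move=> tinf.
have [r pr] : exists r, 0 < p r.
  apply: contrapT => nop; have : series p @ \oo --> (0 : R).
    rewrite (_ : series p = cst 0); first exact: cvg_cst.
    apply/funext => n; rewrite /series /= big1 // => k _.
    apply/eqP; rewrite eq_le p_ge0 andbT leNgt; apply/negP => pk.
    by apply: nop; exists k.
  by move/(cvg_unique (@Rhausdorff R) p_sum)/eqP; rewrite oner_eq0.
have r0 : (0 < r)%N by rewrite lt0n; apply: contraTneq pr => ->; rewrite p0 ltxx.
have uC n : `|u n| <= 1 by rewrite ger0_norm // u_le1.
have [l [n_ [lsup nj vl]]] := limsup_attained uC.
have noo (s M : nat) : \forall j \near \oo, (M <= n_ j - s)%N.
  near=> j; rewrite leq_subRL; last first.
    by apply: leq_trans (nj j); near: j; exact: nbhs_infty_ge.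
  by apply: leq_trans (nj j); near: j; exact: nbhs_infty_ge.
have up n : (0 < n)%N -> u n = convol p u n.
  by move=> n0; rewrite uE -[_ == _]negbK -lt0n n0 add0r.
have Gr i : u (n_ j - i * r)%N @[j --> \oo] --> l.
  elim: i => [|i IH]; first by under eq_cvg do rewrite mul0n subn0.
  under eq_cvg do rewrite mulSnr subnDA.
  exact: (limsup_shift uC up lsup (noo _) IH).
have block (F : nat -> R) J : (forall k, 0 <= F k) ->
    \sum_(0 <= i < J) F (i * r)%N <= \sum_(0 <= k < J * r) F k.
  move=> F0; elim: J => [|J IH]; first by rewrite mul0n !big_nil.
  rewrite big_nat_recr //= [leRHS](@big_cat_nat _ _ _ (J * r)) //=; last first.
    by rewrite leq_mul2r leqnSn orbT.
  apply: lerD => //; rewrite big_ltn; last by rewrite ltn_mul2r r0 ltnSn.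
  by rewrite lerDl; apply: sumr_ge0.
(* As [tail] is nonincreasing, a block of [r] consecutive terms is at most [r] times its first
   term. *)
have tblock J : series tail (J * r)%N <= r%:R * \sum_(0 <= i < J) tail (i * r)%N.
  elim: J => [|J IH]; first by rewrite mul0n /series /= !big_nil mulr0.
  rewrite big_nat_recr //= mulrDr /series /=.
  rewrite [leLHS](@big_cat_nat _ _ _ (J * r)) //=; last first.
    by rewrite leq_mul2r leqnSn orbT.
  apply: lerD => //.
  apply: (@le_trans _ _ (\sum_(J * r <= k < J.+1 * r) tail (J * r)%N)).
    rewrite big_nat_cond [leRHS]big_nat_cond.
    by apply: ler_sum => k /andP[/andP[jk _] _]; exact: tail_nonincreasing.
  by rewrite sumr_const_nat mulSnr addKn mulr_natl.
(* The terms of [tail * u = 1] at the multiples of [r] sum to at most 1; then [j] tends to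
   infinity. *)
have lJ J : (\sum_(0 <= i < J) tail (i * r)%N) * l <= 1.
  have : \sum_(0 <= i < J) tail (i * r)%N * u (n_ j - i * r)%N @[j --> \oo]
      --> (\sum_(0 <= i < J) tail (i * r)%N) * l.
    rewrite mulr_suml; apply: cvg_sum => i.
    by apply: cvgM; [exact: cvg_cst | exact: Gr].
  move=> cv; rewrite -(cvg_lim (@Rhausdorff R) cv); apply: limr_le.
    by apply/cvg_ex; eexists; exact: cv.
  near=> j.
  rewrite -(convol_tail (n_ j)).
  apply: le_trans (block (fun k => tail k * u (n_ j - k)%N) J _) _.
    by move=> k; rewrite mulr_ge0 ?tail_ge0.
  rewrite /convol -(big_mkord xpredT (fun k => tail k * u (n_ j - k)%N)).
  rewrite [leRHS](@big_cat_nat _ _ _ (J * r)) //=; last first.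
    by apply: leq_trans (leqnSn _); apply: leq_trans (nj j); near: j; exact: nbhs_infty_ge.
  by rewrite lerDl; apply: sumr_ge0 => k _; rewrite mulr_ge0 ?tail_ge0.
have l0 : l <= 0.
  rewrite leNgt; apply/negP => l0.
  (* For positive [l], [tblock] and [lJ] would bound every partial sum of the tail by [r%:R / l]. *)
  have [n nP] := tinf (r%:R / l + 1).
  have : series tail n <= r%:R / l; last by move: nP; lra.
  apply: (@le_trans _ _ (series tail (n * r)%N)).
    by apply: nondecreasing_series => [k _ _|]; [exact: tail_ge0 | rewrite leq_pmulr].
  apply: (le_trans (tblock n)); rewrite ler_wpM2l //.
  by rewrite -div1r ler_pdivlMr.
apply/cvgrPdist_lt => e e0.
have := lsup e e0; apply: filterS => n un.
rewrite sub0r normrN ger0_norm //; apply: lt_le_trans un _.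
by rewrite gerDr.
Unshelve. all: by end_near. Qed.

End Renewal.

(** * Limits of convolutions with the renewal sequence *)

Section ConvolutionLimits.
Context (R : realType).

(** Tannery's theorem for the terms [b k * x (t - k)]: each tends to [b k * l], and [C * g k]
    dominates. *)
Lemma convol_cvg (b x g : nat -> R) (C l gl : R) :
  (forall n, `|x n| <= C) -> x @ \oo --> l ->
  (forall n, `|b n| <= g n) -> series g @ \oo --> gl ->
  convol b x @ \oo --> limn (series b) * l.
Proof.
move=> xC xl bg gc.
have C0 : 0 <= C by exact: le_trans (normr_ge0 _) (xC 0%N).
have bc := dominated_series_cvg bg gc.
have -> : limn (series b) * l = limn (series (fun n => b n * l)).
  apply/esym/cvg_lim => //.
  rewrite (_ : series _ = (fun n => series b n * l)).
    by apply: cvgM => //; exact: cvg_cst.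
  by apply/funext => n; rewrite /series /= mulr_suml.
rewrite (_ : convol b x = (fun t => \sum_(0 <= k < t.+1) b k * x (t - k)%N)).
  apply: (@tannery _ _ (fun n => C * g n) _ succn (C * gl)).
  - by move=> M; near=> j; apply: leq_trans (leqnSn _); near: j; exact: nbhs_infty_ge.
  - by move=> j k; rewrite normrM mulrC ler_pM.
  - rewrite (_ : series _ = (fun n => C * series g n)).
      by apply: cvgM => //; exact: cvg_cst.
    by apply/funext => n; rewrite /series /= mulr_sumr.
  - move=> k; apply: cvgM; first exact: cvg_cst.
    rewrite -(cvg_shiftn k).
    by rewrite (_ : (fun n => _) = x) //; apply/funext => n /=; rewrite addnK.
by apply/funext => t; rewrite /convol big_mkord.
Unshelve. all: by end_near. Qed.

Context (p u : nat -> R) (p_ge0 : forall r, 0 <= p r) (p0 : p 0%N = 0)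
  (p_sum : series p @ \oo --> (1 : R)).
Context (u_ge0 : forall t, 0 <= u t)
  (uE : forall t, u t = (t == 0%N)%:R + convol p u t).
Context (y : nat -> R) (C : R) (yC : forall n, `|y n| <= C).

Let a := fun n => tail p n * y n.

Lemma norm_tailM n : `|a n| <= C * tail p n.
Proof. by rewrite normrM ger0_norm ?tail_ge0 // mulrC ler_wpM2r ?tail_ge0. Qed.

Lemma series_Ctail_cvg (mu : R) : series (tail p) @ \oo --> mu ->
  series (fun n => C * tail p n) @ \oo --> C * mu.
Proof.
move=> tmu; rewrite (_ : series _ = (fun n => C * series (tail p) n)).
  by apply: cvgM => //; exact: cvg_cst.
by apply/funext => n; rewrite /series /= mulr_sumr.
Qed.

Lemma renewal_convol_cvg (mu : R) :
  (forall k : nat, (forall r, p r != 0 -> (k %| r)%N) -> k = 1%N) ->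
  series (tail p) @ \oo --> mu ->
  convol u a @ \oo --> mu^-1 * limn (series a).
Proof.
move=> aper tmu; rewrite mulrC.
rewrite (_ : convol u a = convol a u); last by apply/funext => t; exact: convolC.
apply: (convol_cvg _ _ norm_tailM (series_Ctail_cvg tmu)).
  by move=> n; rewrite ger0_norm //; exact: u_le1.
exact: renewal_theorem.
Qed.

(* Convolving once more with the tail turns [u * a] into the partial sums of [a],
   since [tail * u = 1]. *)
Lemma renewal_convol_limit (mu L : R) : series (tail p) @ \oo --> mu ->
  convol u a @ \oo --> L -> L = mu^-1 * limn (series a).
Proof.
move=> tmu uL.
have mu0 : mu != 0.
  rewrite gt_eqF //; apply: lt_le_trans ltr01 _.
  apply: le_trans (series_tail_ge1 p_ge0 p0 p_sum 0) _.
  exact: series_le_lim (tail_ge0 p_ge0 p_sum) tmu.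
have [D uD] : exists D, forall n, `|convol u a n| <= D.
  have /cvg_seq_bounded [M [_ MP]] : cvgn (convol u a) by apply/cvg_ex; exists L.
  by exists (M + 1) => n; apply: MP => //; rewrite ltrDl.
have tailn n : `|tail p n| <= tail p n by rewrite ger0_norm // tail_ge0.
have := convol_cvg uD uL tailn tmu.
have -> : convol (tail p) (convol u a) = (fun t => series a t.+1).
  apply/funext => t; rewrite -convolA /convol /series /= big_mkord.
  rewrite (reindex_inj rev_ord_inj) /=; apply: eq_bigr => k _.
  rewrite subSS; rewrite -/(convol (tail p) u (t - k)) (convol_tail p0 uE) mul1r subKn //.
  by rewrite -ltnS.
rewrite (cvg_shiftS (series a)) (cvg_lim (@Rhausdorff R) tmu) => ac.
by rewrite (cvg_lim (@Rhausdorff R) ac) mulKf.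
Qed.

(** Because [tail * u = 1], the numbers [tail p k * u (t - k)] are weights of total mass 1, and
    since [u] tends to 0 every fixed [k] loses its weight as [t] grows. The average of [y] thus
    follows its values at large [k]. *)
Lemma renewal_null_convol_cvg (l : R) : (forall M, exists n, M <= series (tail p) n) ->
  y @ \oo --> l -> convol u a @ \oo --> l.
Proof.
move=> tinf yl.
have u0 := renewal_null p_ge0 p0 p_sum u_ge0 uE tinf.
have t0 := tail_ge0 p_ge0 p_sum.
have aE t : convol u a t - l =
    \sum_(0 <= k < t.+1) tail p k * u (t - k)%N * (y k - l).
  under eq_bigr do rewrite mulrBr; rewrite sumrB -mulr_suml.
  rewrite -[in LHS](mul1r l) -(convol_tail p0 uE t) convolC /convol !big_mkord.
  by congr (_ - _); apply: eq_bigr => k _; rewrite mulrAC.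
apply/cvgrPdist_le => e e0.
have e2 : 0 < e / 2 by rewrite divr_gt0.
have [B _ BP] : \forall n \near \oo, `|l - y n| <= e / 2.
  by move: yl => /cvgrPdist_le; exact.
have : \sum_(0 <= k < B) tail p k * u (t - k)%N * (y k - l) @[t --> \oo] -->
    \sum_(0 <= k < B) tail p k * 0 * (y k - l).
  apply: cvg_sum => k; apply: cvgM; last exact: cvg_cst.
  apply: cvgM; first exact: cvg_cst.
  rewrite -(cvg_shiftn k).
  by rewrite (_ : (fun n => _) = u) //; apply/funext => n /=; rewrite addnK.
rewrite big1; last by move=> k _; rewrite mulr0 mul0r.
move=> /cvgrPdist_le/(_ _ e2) sB.
near=> t.
have Bt : (B <= t.+1)%N by apply: leq_trans (leqnSn _); near: t; exact: nbhs_infty_ge.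
rewrite distrC aE (@big_cat_nat _ _ _ B) //=.
apply: (le_trans (ler_normD _ _)); rewrite [e]splitr; apply: lerD.
  by rewrite -normrN -sub0r; near: t; exact: sB.
apply: (le_trans (ler_norm_sum _ _ _)).
apply: (@le_trans _ _ (\sum_(B <= k < t.+1) tail p k * u (t - k)%N * (e / 2))).
  rewrite big_nat_cond [leRHS]big_nat_cond; apply: ler_sum => k /andP[/andP[Bk _] _].
  rewrite normrM [`|_ * u _|]ger0_norm ?mulr_ge0 // ler_wpM2l ?mulr_ge0 //.
  by rewrite distrC; exact: BP.
rewrite -mulr_suml ger_pMl // -(convol_tail p0 uE t) /convol.
rewrite -(big_mkord xpredT (fun k => tail p k * u (t - k)%N)).
rewrite [leRHS](@big_cat_nat _ _ _ B) //= lerDr.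
by apply: sumr_ge0 => k _; rewrite mulr_ge0.
Unshelve. all: by end_near. Qed.

End ConvolutionLimits.

(** * Waiting times and reset times *)

Section SeriesInExtendedReals.
Context (R : realType) (f : nat -> R) (f_ge0 : forall n, 0 <= f n).

Lemma nneseries_EFin_cvg :
  (series f n)%:E @[n --> \oo] --> (\sum_(0 <= n <oo) (f n)%:E)%E.
Proof.
have : cvgn (fun n => \sum_(0 <= k < n) (f k)%:E)%E.
  by apply: is_cvg_nneseries => n _ _; rewrite lee_fin.
by under eq_fun do rewrite sumEFin.
Qed.

Lemma nneseries_fin_cvg : (\sum_(0 <= n <oo) (f n)%:E < +oo)%E ->
  series f @ \oo --> fine (\sum_(0 <= n <oo) (f n)%:E)%E.
Proof.
move=> foo; have fin : (\sum_(0 <= n <oo) (f n)%:E)%E \is a fin_num.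
  by rewrite ge0_fin_numE // nneseries_ge0 // => n _ _; rewrite lee_fin.
have := nneseries_EFin_cvg; rewrite -{1}(fineK fin).
by move=> /fine_cvgP[_].
Qed.

Lemma nneseries_infty_unbounded : (\sum_(0 <= n <oo) (f n)%:E = +oo)%E ->
  forall M, exists n, M <= series f n.
Proof.
move=> foo M; have := nneseries_EFin_cvg; rewrite foo => /cvgeryP/cvgryPge /(_ M).
by case=> n _ /(_ n (leqnn n)); exists n.
Qed.

End SeriesInExtendedReals.

(** * Tail, mean and generating function of a waiting time *)

Section WaitingTime.
Context (R : realType) (d : measure_display) (Omega : measurableType d)
  (P : probability Omega R).
Implicit Type X : {RV P >-> nat}.

Lemma law_ge0 X r : 0 <= law X r.
Proof. by rewrite fine_ge0. Qed.

Lemma lawE X r : (law X r)%:E = P (X @^-1` [set r]).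
Proof. by rewrite /law fineK // fin_num_measure. Qed.

Lemma law_sum X : series (law X) @ \oo --> (1 : R).
Proof.
have e1 : (\sum_(0 <= r <oo) (law X r)%:E = 1)%E.
  transitivity (\sum_(0 <= r <oo | r \in setT) P (X @^-1` [set r]))%E.
    rewrite (eq_eseriesr (fun r _ => lawE X r)).
    by apply: eq_eseriesl => r; rewrite in_setT.
  rewrite -measure_bigcup.
  - rewrite -preimage_bigcup -(@probability_setT _ _ _ P); congr (P _).
    by apply/seteqP; split => // w _; exists (X w).
  - by move=> r _; exact: measurable_funPTI.
  - by move=> r s _ _ [w [/= -> ->]].
have := @nneseries_fin_cvg _ _ (law_ge0 X); rewrite e1; apply.
exact: ltry.
Qed.

Lemma probability_gt X t : P (X @^-1` [set r | (t < r)%N]) = (tail (law X) t)%:E.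
Proof.
have le n : P (X @^-1` [set r | (r < n)%N]) = (series (law X) n)%:E.
  elim: n => [|n IH].
    by rewrite (_ : _ @^-1` _ = set0) ?measure0 /series /= ?big_nil //; apply/seteqP; split.
  rewrite /series /= big_nat_recr //= EFinD -IH lawE -measureU; first 1 last.
  - exact: measurable_funPTI.
  - exact: measurable_funPTI.
  - by apply/seteqP; split => // w [/= Xn Xe]; move: Xn; rewrite Xe ltnn.
  by congr (P _); apply/seteqP; split => w /=; lia.
rewrite /tail EFinB -le -probability_setC; last exact: measurable_funPTI.
by congr (P _); apply/seteqP; split => w /=; lia.
Qed.

Lemma survivalE X t : survival X t = tail (law X) t.
Proof.
rewrite /survival /tail; apply: cvg_lim => //.
have : series (law X) n - series (law X) t.+1 @[n --> \oo] --> 1 - series (law X) t.+1.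
  by apply: cvgB; [exact: law_sum | exact: cvg_cst].
apply: cvg_trans; apply: near_eq_cvg; near=> n.
rewrite sub_series_geq //; near: n; exact: nbhs_infty_ge.
Unshelve. all: by end_near. Qed.

(** [X] is the sum over [t] of the indicators of [t < X]; these being nonnegative, sum and integral
    may be exchanged even when the mean is infinite. *)
Lemma mean_timeE X : mean_time X = (\sum_(0 <= t <oo) (tail (law X) t)%:E)%E.
Proof.
rewrite /mean_time unlock.
transitivity (\int[P]_w \sum_(0 <= t <oo) (\1_(X @^-1` [set r | (t < r)%N]) w)%:E)%E.
  apply: eq_integral => w _; rewrite (nneseries_split 0 (X w)); last by move=> *; rewrite lee_fin.
  rewrite eseries0 ?adde0; last first.
    move=> t; rewrite add0n => wt _; rewrite indicE memNset //= => lt.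
    by move: wt; rewrite leqNgt lt.
  rewrite add0n big_nat_cond (eq_bigr (fun=> 1%E)).
    by rewrite -big_nat_cond sumEFin big_const_nat subn0 iter_addr addr0.
  by move=> t /andP[tX _]; rewrite indicE mem_set.
rewrite integral_nneseries //.
- apply: eq_eseriesr => t _; rewrite integral_indic //; last exact: measurable_funPTI.
  by rewrite setIT; exact: probability_gt.
- move=> t; apply/measurable_EFinP; apply: measurable_indic; exact: measurable_funPTI.
Qed.

(** Summation by parts; the boundary term [tail n * x ^+ n] vanishes in the limit because [x] has
    modulus at most 1. This produces the quotients of the spectral formula. *)
Lemma gen_fun_tail (X : {RV P >-> nat}) (x : R) : law X 0 = 0 -> `|x| <= 1 ->
  cvgn (series (fun t => tail (law X) t * x ^+ t)) ->
  (1 - gen_fun X x) = (1 - x) * limn (series (fun t => tail (law X) t * x ^+ t)).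
Proof.
move=> X0 x1 cS; set S := series _ in cS *.
have GE n : \sum_(1 <= r < n.+1) law X r * x ^+ r =
    1 - (1 - x) * S n - tail (law X) n * x ^+ n.
  elim: n => [|n IH].
    by rewrite big_nil /S /series /= big_nil mulr0 subr0 tail0 // expr0 mulr1 subrr.
  have -> : S n.+1 = S n + tail (law X) n * x ^+ n by rewrite /S /series /= big_nat_recr.
  rewrite big_nat_recr //= IH tailS exprS; ring.
suff : gen_fun X x = 1 - (1 - x) * limn S - 0 by move=> ->; ring.
apply: cvg_lim => //.
rewrite -(cvg_shiftS (fun n => \sum_(1 <= r < n) _)) /=.
under eq_cvg do rewrite GE.
apply: cvgB.
  apply: cvgB; first exact: cvg_cst.
  by apply: cvgM => //; exact: cvg_cst.
apply: (@squeeze_cvgr _ _ _ _ (fun n => - tail (law X) n) (tail (law X))).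
- near=> n; rewrite -ler_norml normrM normrX ger0_norm.
    by apply: ler_piMr; [|exact: exprn_ile1]; apply: tail_ge0; [exact: law_ge0|exact: law_sum].
  by apply: tail_ge0; [exact: law_ge0|exact: law_sum].
- rewrite -[X in _ --> X]oppr0; apply: cvgN; apply: tail_cvg0; exact: law_sum.
- apply: tail_cvg0; exact: law_sum.
Unshelve. all: by end_near. Qed.

End WaitingTime.

(** * Laws of the reset times and the renewal mass *)

Section ResetTimes.
Context (R : realType) (d : measure_display) (Omega : measurableType d)
  (P : probability Omega R) (dt : nat -> {RV P >-> nat}).
Context (dt_ge1 : forall n w, (1 <= dt n w)%N)
  (dt_indep : mutually_independent dt) (dt_id : identically_distributed dt).

Let p := law (dt 0%N).

(** The [n]-th convolution power of [p]; [reset_time_cylinder] with empty [s] shows that it is the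
    law of the [n]-th reset time. *)
Fixpoint reset_law (n : nat) : nat -> R :=
  if n is m.+1 then convol p (reset_law m) else fun k => (k == 0%N)%:R.

Lemma reset_timeS n w : reset_time dt n.+1 w = (reset_time dt n w + dt n w)%N.
Proof. by rewrite /reset_time big_ord_recr. Qed.

Lemma law0 n : law (dt n) 0 = 0.
Proof.
rewrite /law /distribution /pushforward (_ : _ @^-1` _ = set0) ?measure0 //.
by apply/seteqP; split => // w /= w0; move: (dt_ge1 n w); rewrite w0.
Qed.

Lemma lawS n : law (dt n) = p.
Proof. by apply/funext => r; rewrite /p /law dt_id. Qed.

Lemma reset_time_measurable n (A : set nat) : measurable (reset_time dt n @^-1` A).
Proof.
elim: n A => [|n IH] A.
  rewrite (_ : reset_time dt 0 = cst 0%N); last first.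
    by apply/funext => w; rewrite /reset_time big_ord0.
  by rewrite preimage_cst; case: ifP.
rewrite (_ : _ @^-1` _ = \bigcup_r (dt n @^-1` [set r] `&`
    reset_time dt n @^-1` [set j | A (j + r)%N])); last first.
  apply/seteqP; split => w /=; first by rewrite reset_timeS => Aw; exists (dt n w).
  by move=> [r _ [/= <-]]; rewrite reset_timeS.
apply: bigcupT_measurable => r; apply: measurableI; last exact: IH.
exact: measurable_funPTI.
Qed.

Lemma total_probability (X : {RV P >-> nat}) (B : set Omega) m : measurable B ->
  (forall w, B w -> (X w < m)%N) ->
  P B = (\sum_(0 <= r < m) P (B `&` X @^-1` [set r]))%E.
Proof.
move=> mB Bm.
have mBX A : measurable (B `&` X @^-1` A).
  by apply: measurableI => //; exact: measurable_funPTI.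
have le n : P (B `&` X @^-1` [set r | (r < n)%N]) =
    (\sum_(0 <= r < n) P (B `&` X @^-1` [set r]))%E.
  elim: n => [|n IH].
    by rewrite big_nil (_ : _ `&` _ = set0) ?measure0 //; apply/seteqP; split => // w [].
  rewrite big_nat_recr //= -IH -measureU //.
    by congr (P _); rewrite -setIUr; congr (_ `&` _); apply/seteqP; split => w /=; lia.
  by apply/seteqP; split => // w /= [[_ Xn] [_ Xe]]; move: Xn; rewrite Xe ltnn.
by rewrite -le; congr (P _); apply/seteqP; split => [w Bw|w []//]; split => //; exact: Bm.
Qed.

(* The last factor is an arbitrary cylinder on the waiting times from the [n]-th
   on, which is what the induction on [n] consumes. *)
Lemma reset_time_cylinder n k (s : seq nat) (A : nat -> set nat) : uniq s ->
  (forall m, m \in s -> (n <= m)%N) ->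
  P (reset_time dt n @^-1` [set k] `&` \bigcap_(m in [set` s]) (dt m @^-1` A m)) =
  ((reset_law n k)%:E * \prod_(m <- s) P (dt m @^-1` A m))%E.
Proof.
elim: n k s A => [|n IH] k s A us sn.
  rewrite /= (_ : reset_time dt 0 = cst 0%N); last first.
    by apply/funext => w; rewrite /reset_time big_ord0.
  rewrite preimage_cst; case: (eqVneq k 0%N) => [->|k0].
    by rewrite mem_set // setTI mul1e dt_indep.
  by rewrite memNset /= ?set0I ?measure0 ?mul0e //; apply/eqP; rewrite eq_sym.
have mF : measurable (\bigcap_(m in [set` s]) (dt m @^-1` A m)).
  by apply: bigcap_measurableType => m _; exact: measurable_funPTI.
rewrite (@total_probability (dt n) _ k.+1); first last.
- by move=> w [/= <- _]; rewrite reset_timeS ltnS leq_addl.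
- by apply: measurableI => //; exact: reset_time_measurable.
have nns : n \notin s by apply/negP => /sn; rewrite ltnn.
have [c cE] : exists c : R, (\prod_(m <- s) P (dt m @^-1` A m))%E = c%:E.
  by eexists; rewrite -dt_indep // -[LHS]fineK // fin_num_measure.
rewrite cE.
rewrite /= /convol -EFinM mulr_suml.
rewrite -(big_mkord xpredT (fun r => p r * reset_law n (k - r)%N * c)).
rewrite -sumEFin big_nat_cond [RHS]big_nat_cond; apply: eq_bigr => r /andP[/andP[_ rk] _].
(* The event [dt n = r] becomes one more factor of the cylinder, at the new index [n], so that the
   induction hypothesis applies to [n :: s]. *)
pose A' m := if m == n then [set r] else A m.
rewrite (_ : _ `&` _ = reset_time dt n @^-1` [set (k - r)%N] `&`
    \bigcap_(m in [set` n :: s]) (dt m @^-1` A' m)); last first.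
  apply/seteqP; split => w /=.
    move=> [[Jk Fw] Xr]; split; first by move: Jk; rewrite reset_timeS Xr; lia.
    move=> m /=; rewrite inE /A'; case: eqVneq => [-> //|_ /=] ms; exact: Fw.
  move=> [Jk Fw]; have : (A' n) (dt n w) by apply: Fw; rewrite /= inE eqxx.
  rewrite /A' eqxx /= => Xr; split => //; split; first by rewrite reset_timeS Xr Jk; lia.
  move=> m /= ms; have : (A' m) (dt m w) by apply: Fw; rewrite /= inE ms orbT.
  by rewrite /A' ifN //; apply: contraNneq nns => <-.
rewrite IH; first last.
- by move=> m; rewrite inE => /orP[/eqP-> //|/sn]; exact: ltnW.
- by rewrite /= nns us.
rewrite big_cons {1}/A' eqxx -lawE lawS.
rewrite (_ : (\prod_(m <- s) _)%E = c%:E); first by rewrite -!EFinM mulrA (mulrC (p r)).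
rewrite -cE.
by apply: eq_big_seq => m ms; rewrite /A' ifN //; apply: contraNneq nns => <-.
Qed.

Lemma reset_time_law n k b :
  P (reset_time dt n @^-1` [set k] `&` dt n @^-1` [set r | (b < r)%N]) =
  (reset_law n k * tail p b)%:E.
Proof.
have := @reset_time_cylinder n k [:: n] (fun=> [set r | (b < r)%N]) isT.
rewrite big_seq1 probability_gt lawS EFinM => <-; last first.
  by move=> m; rewrite inE => /eqP->.
congr (P (_ `&` _)); apply/seteqP; split => w /=.
  by move=> nw m /=; rewrite inE => /eqP->.
by apply; rewrite /= inE.
Qed.

Lemma reset_law_ge0 n k : 0 <= reset_law n k.
Proof.
elim: n k => [|n IH] k /=; first exact: ler0n.
by apply: sumr_ge0 => i _; rewrite mulr_ge0 // law_ge0.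
Qed.

Lemma reset_law_small n k : (k < n)%N -> reset_law n k = 0.
Proof.
elim: n k => // n IH k kn /=; rewrite /convol big_ord_recl /p law0 mul0r add0r big1 // => i _.
by rewrite IH ?mulr0 //= /bump /= ; have := ltn_ord i; lia.
Qed.

(** The expected number of resets at time [k]; waiting times are at least 1, so at most [k] waiting
    times can add up to [k] and the sum over [n] stops there. *)
Definition renewal_mass (k : nat) : R := \sum_(n < k.+1) reset_law n k.

Lemma renewal_mass_ge0 k : 0 <= renewal_mass k.
Proof. by apply: sumr_ge0 => n _; exact: reset_law_ge0. Qed.

Lemma renewal_massE m k : (k < m)%N -> renewal_mass k = \sum_(n < m) reset_law n k.
Proof.
move=> km; rewrite /renewal_mass -!(big_mkord xpredT (fun n => reset_law n k)).
rewrite [RHS](@big_cat_nat _ _ _ k.+1) //= [X in _ + X]big_nat_cond.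
by rewrite [X in _ + X]big1 ?addr0 // => n /andP[/andP[kn _] _]; exact: reset_law_small.
Qed.

Lemma renewal_mass_eq k :
  renewal_mass k = (k == 0%N)%:R + convol p renewal_mass k.
Proof.
(* Once [n = 0] is split off, this bound leaves [k.+1] convolution powers, enough to recover the
   renewal mass at every index up to [k]. *)
rewrite (@renewal_massE k.+2) // big_ord_recl /=; congr (_ + _).
rewrite /convol exchange_big /=; apply: eq_bigr => i _.
by rewrite (@renewal_massE k.+1) ?mulr_sumr // ltnS leq_subr.
Qed.

(** [Theta] is nonzero exactly when the reset time is some [k <= t] and the next waiting time
    exceeds [t - k]. The integrand is thus a finite combination of indicators, whose probabilities
    factor by [reset_time_law]. *)
Lemma reset_expectation (M : nat -> R) t n : (forall b, 0 <= M b) ->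
  real_expectation P (fun w =>
    Theta R (reset_time dt n w) t (reset_time dt n.+1 w) *
      M (t - reset_time dt n w)%N) =
  convol (reset_law n) (fun b => tail p b * M b) t.
Proof.
move=> M0; rewrite /real_expectation unlock.
pose A k := reset_time dt n @^-1` [set k] `&` dt n @^-1` [set r | (t - k < r)%N].
have mA k : measurable (A k).
  by apply: measurableI; [exact: reset_time_measurable | exact: measurable_funPTI].
transitivity (fine (\int[P]_w \sum_(k <- iota 0 t.+1) ((M (t - k)%N)%:E * (\1_(A k) w)%:E))%E).
  congr fine; apply: eq_integral => w _; rewrite /Theta reset_timeS.
  set J := reset_time dt n w.
  have [Jt|tJ] := leqP J t; last first.
    rewrite mul0r big1_seq // => k /andP[_]; rewrite mem_iota => kt.
    rewrite indicE memNset ?mule0 // => -[/= kJ _].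
    by move: tJ; rewrite /J kJ; lia.
  rewrite (bigD1_seq J) ?iota_uniq ?mem_iota //=.
  rewrite big1_seq ?adde0; last first.
    move=> k /andP[kJ _]; rewrite indicE memNset ?mule0 // => -[/= kJ' _].
    by move: kJ; rewrite -kJ' eqxx.
  rewrite -EFinM mulrC indicE; congr ((_ * (nat_of_bool _)%:R)%:E).
  apply/idP/idP; first by move=> lt; rewrite inE /A /=; split => //; rewrite -/J; lia.
  by rewrite inE => -[/= _]; rewrite -/J; lia.
rewrite ge0_integral_sum //; first last.
- by move=> k w _; rewrite mule_ge0 // lee_fin.
- by move=> k; apply: emeasurable_funM => //; apply/measurable_EFinP; exact: measurable_indic.
rewrite (eq_bigr (fun k => (M (t - k)%N * (reset_law n k * tail p (t - k)))%:E)); last first.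
  move=> k _; rewrite ge0_integralZl //; last 2 first.
  - by apply/measurable_EFinP; exact: measurable_indic.
  - by rewrite lee_fin.
  rewrite integral_indic // setIT EFinM; congr (_ * _)%E; exact: reset_time_law.
rewrite sumEFin /= /convol.
rewrite -(big_mkord xpredT (fun k => reset_law n k * (tail p (t - k) * M (t - k)%N))).
by rewrite /index_iota subn0; apply: eq_bigr => k _; ring.
Qed.

End ResetTimes.

(** * The walk on the graph *)

Section GraphWalks.
Context (N : nat) (e : rel 'I_N).
Context (e_simple : simple_graph e) (e_conn : connected_graph e)
  (e_nonbip : ~ bipartite_graph e).
Implicit Types i j k : 'I_N.

Fixpoint walk n i j :=
  if n is m.+1 then [exists k, e i k && walk m k j] else i == j.

Lemma walkS n i j k : e i j -> walk n j k -> walk n.+1 i k.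
Proof. by move=> ij jk; apply/existsP; exists j; rewrite ij. Qed.

Lemma walk1 i j : e i j -> walk 1 i j.
Proof. by move=> ij; apply/existsP; exists j; rewrite ij /=. Qed.

Lemma walk_cat m n i j k : walk m i j -> walk n j k -> walk (m + n) i k.
Proof.
elim: m i => [|m IH] i /=; first by move/eqP->.
move=> /existsP[l /andP[il lj]] jk.
by apply: (walkS il); exact: IH.
Qed.

Lemma walk_sym n i j : walk n i j -> walk n j i.
Proof.
elim: n i => [|n IH] i /=; first by rewrite eq_sym.
move=> /existsP[k /andP[ik kj]].
suff : walk (n + 1) j i by rewrite addn1.
apply: walk_cat (IH _ kj) _.
by apply: walk1; rewrite e_simple.1.
Qed.

Lemma connected_walk i j : exists n, walk n i j.
Proof.
have /connectP[p] := e_conn i j; elim: p i => [|k p IH] i /=.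
  by move=> _ ->; exists 0%N => /=.
move=> /andP[ik kp] jl; have [n kj] := IH k kp jl.
by exists n.+1; exact: walkS kj.
Qed.

Lemma exists_neighbor i : exists j, e i j.
Proof.
apply: contrapT => noj; apply: e_nonbip; exists (fun=> true) => k l kl.
exfalso; have [[|n] /=] := connected_walk i k.
  by move/eqP => ik; apply: noj; exists l; rewrite ik.
by move=> /existsP[m /andP[im _]]; apply: noj; exists m.
Qed.

Lemma closed_walk2 n i : walk n.*2 i i.
Proof.
elim: n => [|n IH]; first exact: eqxx.
have [j ij] := exists_neighbor i.
have ji : e j i by rewrite e_simple.1.
rewrite doubleS -addn2; apply: (walk_cat IH).
exact: (@walk_cat 1 1 _ _ _ (walk1 ij) (walk1 ji)).
Qed.

(* Otherwise the parity of the walks from [i] would be a proper 2-colouring. *)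
Lemma odd_closed_walk i : exists2 n, odd n & walk n i i.
Proof.
apply: contrapT => noodd; apply: e_nonbip.
exists (fun j => `[< exists2 n, odd n & walk n i j >]) => j k jk.
have kj : e k j by rewrite e_simple.1.
have ext n l m : walk n i l -> e l m -> walk n.+1 i m.
  by move=> il lm; rewrite -addn1; apply: (walk_cat il); exact: walk1.
case: asboolP => [[n on ij]|noj]; case: asboolP => [[m om ik]|nok] //; exfalso.
  apply: noodd; exists (n.+1 + m)%N; first by rewrite oddD /= on om.
  by apply: (walk_cat (ext _ _ _ ij jk)); exact: walk_sym.
have [n ij] := connected_walk i j.
have [on|en] := boolP (odd n); first by apply: noj; exists n.
by apply: nok; exists n.+1; [|exact: ext jk].
Qed.

(** A fixed walk from [i] to [j] is prolonged by steps back and forth at [i], preceded by one odd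
    closed walk when the parity has to change. *)
Lemma walk_eventually i j : exists n0, forall n, (n0 <= n)%N -> walk n i j.
Proof.
have [a ij] := connected_walk i j.
have [b ob bi] := odd_closed_walk i.
exists (a + b)%N => n abn.
have [par|par] := boolP (odd (n - a)).
  have ev : (n - (a + b) = ((n - (a + b))./2).*2)%N.
    rewrite -[LHS]odd_double_half; suff -> : odd (n - (a + b)) = false by [].
    by rewrite subnDA oddB ?ob ?par // leq_subRL; lia.
  have -> : (n = b + (n - (a + b))./2.*2 + a)%N by rewrite -ev; lia.
  by apply: (walk_cat _ ij); apply: (walk_cat bi); exact: closed_walk2.
have an : (a <= n)%N by lia.
rewrite -(subnK an); apply: (walk_cat _ ij).
have -> : (n - a = ((n - a)./2).*2)%N by rewrite -[LHS]odd_double_half (negbTE par).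
exact: closed_walk2.
Qed.

Lemma walk_all : exists n, forall i j, walk n i j.
Proof.
have /choice[f fP] (ij : 'I_N * 'I_N) : exists n0, forall n, (n0 <= n)%N -> walk n ij.1 ij.2.
  exact: walk_eventually.
exists (\max_ij f ij)%N => i j; apply: (fP (i, j)).
exact: (@leq_bigmax _ f (i, j)).
Qed.

End GraphWalks.

(** * Convergence of the powers of a stochastic matrix *)

Section Ergodicity.
Context (R : realType) (N : nat).
Implicit Types (W : 'M[R]_N) (x y : 'rV[R]_N).

Definition stochastic W := (forall i j, 0 <= W i j) /\ forall i, \sum_j W i j = 1.

Definition norm1 x : R := \sum_j `|x 0 j|.

Lemma stochastic_exp W n : stochastic W -> stochastic (W ^+ n).
Proof.
move=> [W0 W1]; elim: n => [|n [IH0 IH1]].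
  split=> [i j|i]; first by rewrite expr0 mxE ler0n.
  rewrite expr0 (bigD1 i) //= mxE eqxx big1 ?addr0 // => j ji.
  by rewrite mxE eq_sym (negbTE ji).
rewrite exprS; split=> [i j|i].
  by rewrite mxE; apply: sumr_ge0 => k _; rewrite mulr_ge0.
under eq_bigr do rewrite mxE.
rewrite exchange_big /= -(W1 i); apply: eq_bigr => k _.
by rewrite -mulr_sumr IH1 mulr1.
Qed.

Lemma stochastic_le1 W i j : stochastic W -> W i j <= 1.
Proof.
move=> [W0 W1]; rewrite -(W1 i) (bigD1 j) //= lerDl.
by apply: sumr_ge0.
Qed.

(** On a zero-sum [x], subtracting [c] from all entries of [W] does not change the product, and the
    remaining nonnegative matrix has row sums [1 - N%:R * c]. *)
Lemma norm1_mulmx W (c : R) x : (forall i j, c <= W i j) ->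
  (forall i, \sum_j W i j = 1) -> \sum_j x 0 j = 0 ->
  norm1 (x *m W) <= (1 - N%:R * c) * norm1 x.
Proof.
move=> cW W1 x0.
have -> : (1 - N%:R * c) * norm1 x = \sum_j \sum_i `|x 0 i| * (W i j - c).
  rewrite exchange_big /= mulr_sumr; apply: eq_bigr => i _.
  by rewrite -mulr_sumr sumrB W1 sumr_const card_ord mulrC mulr_natl.
apply: ler_sum => j _; rewrite mxE.
have -> : \sum_i x 0 i * W i j = \sum_i x 0 i * (W i j - c).
  under [RHS]eq_bigr do rewrite mulrBr.
  by rewrite sumrB -mulr_suml x0 mul0r subr0.
apply: (le_trans (ler_norm_sum _ _ _)); apply: ler_sum => i _.
by rewrite normrM [`|_ - c|]ger0_norm // subr_ge0.
Qed.

Lemma norm1_ge0 x : 0 <= norm1 x.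
Proof. exact: sumr_ge0. Qed.

Lemma sum_mulmx W x : (forall i, \sum_j W i j = 1) ->
  \sum_j (x *m W) 0 j = \sum_j x 0 j.
Proof.
move=> W1; under eq_bigr do rewrite mxE.
rewrite exchange_big /=; apply: eq_bigr => i _.
by rewrite -mulr_sumr W1 mulr1.
Qed.

(* Doeblin: [W ^+ m] with positive entries contracts the l1 norm on zero-sum
   vectors. *)
Lemma zero_sum_cvg W m x : stochastic W -> (forall i j, 0 < (W ^+ m) i j) ->
  \sum_j x 0 j = 0 -> norm1 (x *m W ^+ n) @[n --> \oo] --> (0 : R).
Proof.
move=> sW Wm x0.
have x0n n : \sum_j (x *m W ^+ n) 0 j = 0.
  by rewrite sum_mulmx //; exact: (stochastic_exp n sW).2.
pose a n := norm1 (x *m W ^+ n).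
have a0 n : 0 <= a n by exact: norm1_ge0.
(* The contraction estimate with [c = 0] makes the norms nonincreasing, so that they have a
   limit. *)
have aS n : a n.+1 <= a n.
  rewrite /a exprSr mulmxA -[leRHS]mul1r -[X in X * _]subr0 -(mulr0 N%:R).
  by apply: norm1_mulmx => //; [exact: sW.1 | exact: sW.2].
have acv : cvgn a.
  apply: nonincreasing_is_cvgn; last by exists 0 => _ [n _ <-].
  by apply/nonincreasing_seqP.
have [N0|N0] := posnP N.
  rewrite (_ : (fun n => norm1 _) = cst 0); first exact: cvg_cst.
  apply/funext => n; rewrite /norm1 big1 // => j; have := ltn_ord j.
  by rewrite [X in (_ < X)%N]N0.
have [c c0 cW] : exists2 c, 0 < c & forall i j, c <= (W ^+ m) i j.
  exists (\big[Num.min/1]_(ij : 'I_N * 'I_N) (W ^+ m) ij.1 ij.2).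
    apply: (@big_ind R (fun z : R => 0 < z)) => // a1 b1 a10 b10.
    by rewrite lt_min a10.
  by move=> i j; exact: (bigmin_le _ (i, j)).
have am n : a (n + m)%N <= (1 - N%:R * c) * a n.
  rewrite /a exprD mulmxA; apply: norm1_mulmx => //.
  exact: (stochastic_exp m sW).2.
(* In the limit [am] bounds [limn a] by itself times a factor less than 1, which forces it to be
   0. *)
have lim0 : limn a <= (1 - N%:R * c) * limn a.
  have cv1 : a (n + m)%N @[n --> \oo] --> limn a by rewrite (cvg_shiftn m a).
  have cv2 : (1 - N%:R * c) * a n @[n --> \oo] --> (1 - N%:R * c) * limn a.
    by apply: cvgM => //; exact: cvg_cst.
  by apply: ler_cvg_to cv1 cv2 _; near=> n.
suff -> : 0 = limn a by [].
apply/eqP; rewrite eq_le; apply/andP; split.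
  by apply: limr_ge => //; near=> n.
rewrite -(@pmulr_rle0 _ (N%:R * c)); last by rewrite mulr_gt0 // ltr0n.
by move: lim0; rewrite mulrBl mul1r; lra.
Unshelve. all: by end_near. Qed.

Lemma stochastic_cvg W m (q x : 'rV[R]_N) : stochastic W ->
  (forall i j, 0 < (W ^+ m) i j) -> q *m W = q -> \sum_j q 0 j = 1 ->
  \sum_j x 0 j = 1 -> forall j, (x *m W ^+ n) 0 j @[n --> \oo] --> q 0 j.
Proof.
move=> sW Wm qW q1 x1 j.
have qWn n : q *m W ^+ n = q.
  elim: n => [|n IH]; first by rewrite expr0 mulmx1.
  by rewrite exprS mulmxA qW.
have d0 : \sum_j (x - q) 0 j = 0.
  under eq_bigr do rewrite !mxE.
  by rewrite sumrB x1 q1 subrr.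
have /cvgrPdist_le cv := zero_sum_cvg sW Wm d0.
apply/cvgrPdist_le => e e0; apply: filterS (cv e e0) => n.
rewrite sub0r normrN ger0_norm; last exact: norm1_ge0.
apply: le_trans; rewrite mulmxBl qWn /norm1 (bigD1 j) //= !mxE distrC lerDl.
exact: sumr_ge0.
Qed.

(** The y_j(b) of the overview: the mass at [j] after [b] steps started from [rho]. *)
Definition relocated_mass W (rho : 'I_N -> R) (j : 'I_N) (b : nat) : R :=
  \sum_l rho l * (W ^+ b) l j.

End Ergodicity.

Lemma cvg_mxP (R : realType) (m n : nat) (f : nat -> 'M[R]_(m, n)) (M : 'M[R]_(m, n)) :
  f @ \oo --> M <-> forall i j, f t i j @[t --> \oo] --> M i j.
Proof.
split=> [fM i j|fM].
  exact: (cvg_comp f (fun A : 'M[R]_(m, n) => A i j) fM (@coord_continuous R m n i j M)).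
move=> A [Q MQ QA].
have : \forall t \near \oo, forall ij : 'I_m * 'I_n, Q ij.1 ij.2 (f t ij.1 ij.2).
  by apply: filter_forall => -[i j]; apply: fM; exact: MQ.
by apply: filterS => t Qt; apply: QA => i j; exact: (Qt (i, j)).
Qed.

(* Multiplying [[1, y], [x, 'X]] by a triangular block matrix on the left or on
   the right computes its determinant in two ways. *)
Lemma char_poly_rank1 (F : fieldType) (n : nat) (x : 'cV[F]_n) (y : 'rV[F]_n) : (0 < n)%N ->
  char_poly (x *m y) = 'X ^+ n.-1 * ('X - ((y *m x) 0 0)%:P).
Proof.
case: n x y => // n x y _.
pose U : 'M[{poly F}]_(n.+1, 1) := map_mx polyC x.
pose V : 'M[{poly F}]_(1, n.+1) := map_mx polyC y.
pose B := block_mx 1%:M V U ('X%:M).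
have cp : char_poly (x *m y) = \det ('X%:M - U *m V).
  by rewrite /char_poly /char_poly_mx map_mxM.
have d1 : \det B = \det ('X%:M - U *m V).
  have : block_mx 1%:M 0 (- U) 1%:M *m B = block_mx 1%:M V 0 ('X%:M - U *m V).
    rewrite mulmx_block !mul1mx !mul0mx !addr0 mulmx1 addNr.
    by rewrite mulNmx addrC.
  move/(congr1 determinant); rewrite det_mulmx det_lblock !det1 !mul1r => ->.
  by rewrite det_ublock det1 mul1r.
have d2 : \det B * 'X = ('X - ((y *m x) 0 0)%:P) * 'X ^+ n.+1.
  have : B *m block_mx ('X%:M) 0 (- U) 1%:M =
      block_mx ('X - ((y *m x) 0 0)%:P)%:M V 0 'X%:M.
    rewrite mulmx_block !mul1mx !mulmx0 !add0r !mulmx1 ; congr block_mx.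
      rewrite mulmxN -map_mxM; apply/matrixP => i j.
      by rewrite !mxE !ord1 eqxx !mulr1n.
    by rewrite mulmxN mul_mx_scalar mul_scalar_mx subrr.
  move/(congr1 determinant); rewrite det_mulmx det_lblock det1 mulr1 det_ublock.
  by rewrite !det_scalar expr1.
have X0 : ('X : {poly F}) != 0 by rewrite polyX_eq0.
apply: (mulIf X0).
by rewrite cp -d1 d2 mulrC exprSr mulrAC.
Qed.

(** * The transition matrix and its equilibrium *)

Section TransitionMatrix.
Context (R : realType) (N : nat) (e : rel 'I_N).
Context (e_simple : simple_graph e) (e_conn : connected_graph e)
  (e_nonbip : ~ bipartite_graph e).

Let W := transition_mx R e.

Lemma adj_mx_ge0 i j : 0 <= adj_mx R e i j.
Proof. by rewrite mxE ler0n. Qed.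

Lemma degree_gt0 i : 0 < degree R e i.
Proof.
have [j ij] := exists_neighbor e_conn e_nonbip i.
rewrite /degree (bigD1 j) //= ltr_pwDl //; first by rewrite mxE ij.
by apply: sumr_ge0 => k _; exact: adj_mx_ge0.
Qed.

Lemma dim_gt0 : (0 < N)%N.
Proof.
rewrite lt0n; apply/eqP => N0; apply: e_nonbip; exists (fun=> true) => i.
by have := ltn_ord i; rewrite [X in (_ < X)%N]N0.
Qed.

Lemma sum_degree_gt0 : 0 < \sum_r degree R e r.
Proof.
rewrite (bigD1 (Ordinal dim_gt0)) //= ltr_pwDl ?degree_gt0 //.
by apply: sumr_ge0 => r _; exact: ltW (degree_gt0 r).
Qed.

Lemma transition_stochastic : stochastic W.
Proof.
split=> [i j|i]; first by rewrite mxE divr_ge0 ?adj_mx_ge0 // ltW // degree_gt0.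
under eq_bigr do rewrite mxE.
by rewrite -mulr_suml mulfV // gt_eqF // degree_gt0.
Qed.

Lemma transition_exp_gt0 n i j : walk e n i j -> 0 < (W ^+ n) i j.
Proof.
elim: n i => [|n IH] i /=; first by move/eqP->; rewrite expr0 mxE eqxx ltr01.
move=> /existsP[k /andP[ik kj]]; rewrite exprS mxE (bigD1 k) //= ltr_pwDl //.
  by rewrite mulr_gt0 ?IH // mxE divr_gt0 ?degree_gt0 // mxE ik.
apply: sumr_ge0 => l _; apply: mulr_ge0; first exact: transition_stochastic.1.
exact: (stochastic_exp n transition_stochastic).1.
Qed.

Definition equilibrium_row : 'rV[R]_N := \row_j (degree R e j / \sum_r degree R e r).

(** Detailed balance: [degree i] times the entry [i, j] is the adjacency entry, which is
    symmetric. *)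
Lemma equilibrium_rowM : equilibrium_row *m W = equilibrium_row.
Proof.
apply/rowP => j; rewrite !mxE /degree mulr_suml; apply: eq_bigr => i _.
rewrite !mxE -/(degree R e i) e_simple.1.
have := degree_gt0 i; have := sum_degree_gt0.
by rewrite /degree => ? ?; field; rewrite !gt_eqF.
Qed.

Lemma equilibrium_row_sum : \sum_j equilibrium_row 0 j = 1.
Proof.
under eq_bigr do rewrite mxE.
by rewrite -mulr_suml mulfV // gt_eqF // sum_degree_gt0.
Qed.

Lemma transition_cvg (x : 'rV[R]_N) j : \sum_k x 0 k = 1 ->
  (x *m W ^+ n) 0 j @[n --> \oo] --> equilibrium_row 0 j.
Proof.
move=> x1; have [m wm] := walk_all e_simple e_conn e_nonbip.
exact: (stochastic_cvg transition_stochastic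
  (fun i k => transition_exp_gt0 (wm i k)) equilibrium_rowM equilibrium_row_sum x1).
Qed.

Lemma transition_exp_cvg i j : (W ^+ n) i j @[n --> \oo] --> equilibrium_row 0 j.
Proof.
have x1 : \sum_k (delta_mx 0 i : 'rV[R]_N) 0 k = 1.
  rewrite (bigD1 i) //= mxE !eqxx big1 ?addr0 // => k ki.
  by rewrite mxE (negbTE ki) andbF.
have -> : (fun n => (W ^+ n) i j) = 
    (fun n => ((delta_mx 0 i : 'rV[R]_N) *m W ^+ n) 0 j).
  by apply/funext => n; rewrite -rowE mxE.
exact: (transition_cvg x1).
Qed.

Lemma relocated_mass_cvg (rho : 'I_N -> R) j : distribution_vector rho ->
  relocated_mass W rho j @ \oo --> degree R e j / \sum_r degree R e r.
Proof.
move=> [_ r1]; have x1 : \sum_k (\row_l rho l) 0 k = 1.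
  by rewrite -r1; apply: eq_bigr => l _; rewrite mxE.
have -> : degree R e j / \sum_r degree R e r = equilibrium_row 0 j by rewrite mxE.
have := @transition_cvg _ j x1.
have -> // : (fun n => ((\row_l rho l) *m W ^+ n) 0 j) = relocated_mass W rho j.
by apply/funext => n; rewrite mxE; apply: eq_bigr => l _; rewrite mxE.
Qed.

End TransitionMatrix.

(** * Spectral consequences of the convergence of the powers *)

Section EigenSystem.
Context (R : realType) (N : nat) (e : rel 'I_N).
Context (e_simple : simple_graph e) (e_conn : connected_graph e)
  (e_nonbip : ~ bipartite_graph e).
Let W := transition_mx R e.
Context (lam : 'I_N -> R) (phi phibar : 'M[R]_N) (es : eigensystem W lam phi phibar).

Let i0 : 'I_N := Ordinal (dim_gt0 e_nonbip).

Lemma eigen_biorth m n : \sum_k phibar m k * phi k n = (m == n)%:R.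
Proof.
have [_ _ /(_ m n) H _ _] := es; have := congr1 (fun A : 'M[R]_1 => A 0 0) H.
rewrite !mxE eqxx mulr1n => <-; apply: eq_bigr => k _; by rewrite !mxE.
Qed.

Lemma exp_eigenvector n m : W ^+ n *m col m phi = lam m ^+ n *: col m phi.
Proof.
have [H _ _ _ _] := es.
elim: n => [|n IH]; first by rewrite !expr0 mul1mx scale1r.
by rewrite exprSr -mulmxA H -scalemxAr IH scalerA -exprS.
Qed.

Lemma exp_eigenvectorE n m i : \sum_k (W ^+ n) i k * phi k m = lam m ^+ n * phi i m.
Proof.
have := congr1 (fun A : 'cV[R]_N => A i 0) (exp_eigenvector n m).
by rewrite !mxE => <-; apply: eq_bigr => k _; rewrite !mxE.
Qed.

Lemma exp_left_eigenvectorE n j : \sum_k phibar i0 k * (W ^+ n) k j = phibar i0 j.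
Proof.
have [_ H _ _ /(_ i0 erefl) l1] := es.
have {}H : row i0 phibar *m W ^+ n = row i0 phibar.
  elim: n => [|n IH]; first by rewrite expr0 mulmx1.
  by rewrite exprS mulmxA H l1 scale1r.
have := congr1 (fun A : 'rV[R]_N => A 0 j) H.
by rewrite !mxE => <-; apply: eq_bigr => k _; rewrite !mxE.
Qed.

Lemma spectral_decomposition n l j :
  (W ^+ n) l j = \sum_m lam m ^+ n * (phi l m * phibar m j).
Proof.
have [_ _ _ H _] := es.
rewrite -[W ^+ n]mulmx1 -H mulmx_sumr summxE; apply: eq_bigr => m _.
by rewrite mulmxA exp_eigenvector -scalemxAl !mxE big_ord1 !mxE.
Qed.

Lemma eigen_neq0 m : exists i, phi i m != 0.
Proof.
apply: contrapT => no0; have := eigen_biorth m m; rewrite eqxx big1.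
  by move/eqP; rewrite eq_sym oner_eq0.
move=> k _; have [->|k0] := eqVneq (phi k m) 0; first by rewrite mulr0.
by exfalso; apply: no0; exists k.
Qed.

(** Maximum principle: at a component of largest modulus, [W] averages components of no larger
    modulus. *)
Lemma eigenvalue_le1 m : `|lam m| <= 1.
Proof.
have [i im] := eigen_neq0 m.
pose l := [arg max_(l > i) `|phi l m|]%O.
have lmax k : `|phi k m| <= `|phi l m|.
  by rewrite /l; case: arg_maxP => // l' _ /(_ k isT).
have l0 : 0 < `|phi l m| by apply: lt_le_trans (lmax i); rewrite normr_gt0.
have sW := transition_stochastic R e_conn e_nonbip.
rewrite -(ler_pM2r l0) mul1r -normrM -[lam m]expr1 -exp_eigenvectorE expr1.
apply: (le_trans (ler_norm_sum _ _ _)).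
apply: (@le_trans _ _ (\sum_k W l k * `|phi l m|)).
  by apply: ler_sum => k _; rewrite normrM ger0_norm ?sW.1 // ler_wpM2l ?sW.1.
by rewrite -mulr_suml sW.2 mul1r.
Qed.

Lemma eigenvector_lim m i :
  lam m ^+ n * phi i m @[n --> \oo] --> \sum_k equilibrium_row R e 0 k * phi k m.
Proof.
under eq_cvg do rewrite -exp_eigenvectorE.
apply: cvg_sum => k; apply: cvgM; last exact: cvg_cst.
exact: transition_exp_cvg.
Qed.

(* An eigenvector for 1 is fixed by [W ^+ n], hence by its limit, whose rows
   are all equal. *)
Lemma eigenvector1_const m i : lam m = 1 ->
  phi i m = \sum_k equilibrium_row R e 0 k * phi k m.
Proof.
move=> l1; have c1 : lam m ^+ n * phi i m @[n --> \oo] --> phi i m.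
  by rewrite l1; under eq_cvg do rewrite expr1n mul1r; exact: cvg_cst.
exact: (cvg_unique (@Rhausdorff R) c1 (@eigenvector_lim m i)).
Qed.

Lemma left_eigenvector0 j :
  phibar i0 j = (\sum_k phibar i0 k) * equilibrium_row R e 0 j.
Proof.
have c1 : \sum_k phibar i0 k * (W ^+ n) k j @[n --> \oo] -->
    \sum_k phibar i0 k * equilibrium_row R e 0 j.
  apply: cvg_sum => k; apply: cvgM; first exact: cvg_cst.
  exact: transition_exp_cvg.
have c2 : \sum_k phibar i0 k * (W ^+ n) k j @[n --> \oo] --> phibar i0 j.
  by under eq_cvg do rewrite exp_left_eigenvectorE; exact: cvg_cst.
by rewrite mulr_suml; exact: (cvg_unique (@Rhausdorff R) c2 c1).
Qed.

Lemma lam0 : lam i0 = 1.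
Proof. by have [_ _ _ _ /(_ i0 erefl)] := es. Qed.

Lemma sum_phibar0 : (\sum_k phibar i0 k) *
  (\sum_k equilibrium_row R e 0 k * phi k i0) = 1.
Proof.
rewrite -[RHS]/((true)%:R) -(eqxx i0) -eigen_biorth mulr_suml.
by apply: eq_bigr => k _; rewrite -(eigenvector1_const k lam0).
Qed.

(** Column 0 of [phi] is constant and row 0 of [phibar] is a multiple of the equilibrium;
    biorthonormality makes the product of the two factors 1. *)
Lemma eigenprojection0 i j : phi i i0 * phibar i0 j = equilibrium_row R e 0 j.
Proof.
rewrite (eigenvector1_const i lam0) left_eigenvector0 mulrA [X in X * _]mulrC.
by rewrite sum_phibar0 mul1r.
Qed.

(** A further eigenvector for 1 would be constant; orthogonal to row 0 of [phibar], whose sum is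
    nonzero by [sum_phibar0], it would vanish. *)
Lemma eigenvalue_neq1 (m : 'I_N) : (0 < m)%N -> lam m != 1.
Proof.
move=> m0; apply/eqP => l1.
have mi0 : (i0 == m) = false by apply/negbTE; rewrite -val_eqE /= eq_sym -lt0n.
have := eigen_biorth i0 m; rewrite mi0.
under eq_bigr do rewrite (eigenvector1_const _ l1).
rewrite -mulr_suml => /eqP; rewrite mulf_eq0 => /orP[/eqP s0|/eqP c0].
  by have := sum_phibar0; rewrite s0 mul0r => /eqP; rewrite eq_sym oner_eq0.
have [i] := eigen_neq0 m.
by rewrite (eigenvector1_const _ l1) c0 eqxx.
Qed.

End EigenSystem.

(** * The propagator *)

Section Propagator.
Context (R : realType) (N : nat) (d : measure_display) (Omega : measurableType d)
  (P : probability Omega R) (dt : nat -> {RV P >-> nat}).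
Context (dt_ge1 : forall n w, (1 <= dt n w)%N)
  (dt_indep : mutually_independent dt) (dt_id : identically_distributed dt).
Context (W : 'M[R]_N) (W_stoch : stochastic W).
Context (rho : 'I_N -> R) (rho_distr : distribution_vector rho).

Let p := law (dt 0%N).
Let u := renewal_mass dt.
Let Rel := relocation_mx rho.
Let relocated_mass := relocated_mass W rho.

Let Wb b := stochastic_exp b W_stoch.
Let p_ge0 : forall r, 0 <= p r := law_ge0 (dt 0%N).
Let p0 : p 0%N = 0 := law0 dt_ge1 0.
Let p_sum : series p @ \oo --> (1 : R) := @law_sum _ _ _ _ (dt 0%N).

Lemma convol_delta (a : nat -> R) t : convol (fun k => (k == 0%N)%:R) a t = a t.
Proof.
rewrite /convol big_ord_recl eqxx mul1r subn0 big1 ?addr0 // => k _.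
by rewrite mul0r.
Qed.

Lemma reset_termE t n i j : reset_term dt W t n i j =
  convol (reset_law dt n) (fun b => tail p b * (W ^+ b) i j) t.
Proof.
rewrite mxE (@reset_expectation _ _ _ _ _ dt_indep dt_id (fun b => (W ^+ b) i j)) // => b.
exact: (Wb b).1.
Qed.

Lemma reset_term_large t n : (t < n)%N -> reset_term dt W t n = 0.
Proof.
move=> tn; apply/matrixP => i j; rewrite reset_termE /convol mxE big1 // => k _.
by rewrite (reset_law_small dt_ge1) ?mul0r // (leq_ltn_trans _ tn) // -ltnS.
Qed.

Lemma reset_seriesE t :
  (\big[+%R/0]_(1 <= n <oo) reset_term dt W t n)%BIG = \sum_(1 <= n < t.+1) reset_term dt W t n.
Proof.
apply: norm_lim_near_cst; near=> n.
have tn : (t.+1 <= n)%N by near: n; exact: nbhs_infty_ge.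
rewrite (@big_cat_nat _ _ _ t.+1) //= [X in _ + X]big_nat_cond.
by rewrite [X in _ + X]big1 ?addr0 // => k /andP[/andP[tk _] _]; exact: reset_term_large.
Unshelve. all: by end_near. Qed.

(** The subtracted term is the missing summand [n = 0], which completes the sum of convolution
    powers to [u]. *)
Lemma reset_series_entry t i j :
  (\big[+%R/0]_(1 <= n <oo) reset_term dt W t n)%BIG i j =
  convol u (fun b => tail p b * (W ^+ b) i j) t - tail p t * (W ^+ t) i j.
Proof.
pose a b := tail p b * (W ^+ b) i j; rewrite -/a -/(a t) reset_seriesE summxE.
rewrite (eq_bigr (fun n => convol (reset_law dt n) a t)); last by move=> n _; exact: reset_termE.
apply: (canRL (addrK _)).
rewrite -[X in _ + X](convol_delta a) addrC -/(reset_law dt 0).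
rewrite -(@big_ltn _ _ _ 0 t.+1 (fun n => convol (reset_law dt n) a t)) // big_mkord.
rewrite /convol exchange_big /=; apply: eq_bigr => k _.
by rewrite -mulr_suml /u (@renewal_massE _ _ _ _ _ dt_ge1 t.+1).
Qed.

Lemma no_reset_expectation t :
  real_expectation P (fun w => Theta R (reset_time dt 0 w) t (reset_time dt 1 w)) = tail p t.
Proof.
have := @reset_expectation _ _ _ _ _ dt_indep dt_id (fun=> 1) t 0 (fun=> ler01).
rewrite (convol_delta (fun b => tail p b * 1)) mulr1 => <-.
by congr real_expectation; apply/funext => w; rewrite mulr1.
Qed.

Lemma propagatorE t i j : propagator dt W Rel t i j =
  tail p t * ((W ^+ t) i j - relocated_mass j t)
  + convol u (fun b => tail p b * relocated_mass j b) t.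
Proof.
rewrite /propagator no_reset_expectation !mxE.
under eq_bigr do rewrite mxE reset_series_entry mulrBr.
rewrite sumrB mulrBr -addrA; congr (_ + _).
rewrite addrC; congr (_ + _).
  rewrite /convol; under eq_bigr do rewrite mulr_sumr.
  rewrite exchange_big /=; apply: eq_bigr => k _.
  rewrite /relocated_mass !mulr_sumr; apply: eq_bigr => l _; ring.
by rewrite /relocated_mass mulr_sumr; congr (- _); apply: eq_bigr => l _; ring.
Qed.

Lemma relocated_mass_norm j b : `|relocated_mass j b| <= 1.
Proof.
have [r0 r1] := rho_distr.
rewrite ger0_norm; last by apply: sumr_ge0 => l _; rewrite mulr_ge0 // (Wb b).1.
rewrite -r1; apply: ler_sum => l _.
by rewrite ler_piMr // stochastic_le1.
Qed.

Lemma entry_norm i j b : `|(W ^+ b) i j| <= 1.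
Proof. by rewrite ger0_norm ?stochastic_le1 //; exact: (Wb b).1. Qed.

(** The two sequences differ by at most [tail p t * 2]. The direction from the propagator to the
    convolution serves to identify a limit that is given. *)
Lemma propagator_convol_cvg i j (l : R) :
  convol u (fun b => tail p b * relocated_mass j b) @ \oo --> l <->
  propagator dt W Rel t i j @[t --> \oo] --> l.
Proof.
have err : tail p t * ((W ^+ t) i j - relocated_mass j t) @[t --> \oo] --> (0 : R).
  have t2 : tail p t * 2 @[t --> \oo] --> (0 : R).
    rewrite -(mul0r (2 : R)); apply: cvgM; last exact: cvg_cst.
    exact: tail_cvg0.
  apply: (@squeeze_cvgr _ _ _ _ (fun t => - (tail p t * 2)) (fun t => tail p t * 2)) => //.
    near=> t; rewrite -ler_norml normrM ger0_norm ?tail_ge0 // ler_wpM2l ?tail_ge0 //.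
    apply: le_trans (ler_normB _ _) _; rewrite -[2]/(1 + 1).
    by rewrite lerD ?entry_norm ?relocated_mass_norm.
  by rewrite -oppr0; exact: (cvgN t2).
split=> H.
  under eq_cvg do rewrite propagatorE.
  by rewrite -(add0r l); exact: (cvgD err H).
have -> : convol u (fun b => tail p b * relocated_mass j b) = (fun t =>
    propagator dt W Rel t i j - tail p t * ((W ^+ t) i j - relocated_mass j t)).
  by apply/funext => t; rewrite propagatorE addrAC subrr add0r.
by rewrite -(subr0 l); exact: (cvgB H err).
Unshelve. all: by end_near. Qed.

Lemma fbar_series_entry n i j :
  fbar_series dt W n i j = series (fun b => tail p b * (W ^+ b) i j) n.
Proof.
rewrite /fbar_series /series /= summxE; apply: eq_bigr => b _.
by rewrite mxE survivalE.
Qed.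

(** * Waiting times of finite mean *)

Section FiniteMean.
Context (mu_fin : (mean_time (dt 0%N) < +oo)%E).
Let mu := fine (mean_time (dt 0%N)).

Lemma tail_series_cvg : series (tail p) @ \oo --> mu.
Proof.
rewrite /mu mean_timeE; apply: nneseries_fin_cvg; last by rewrite -mean_timeE.
exact: tail_ge0.
Qed.

Lemma mean_ge1 : 1 <= mu.
Proof.
apply: le_trans (series_tail_ge1 p_ge0 p0 p_sum 0) _.
exact: series_le_lim (tail_ge0 p_ge0 p_sum) tail_series_cvg.
Qed.

Lemma tailM_series_cvg (y : nat -> R) : (forall b, `|y b| <= 1) ->
  cvgn (series (fun b => tail p b * y b)).
Proof.
move=> y1; apply: dominated_series_cvg tail_series_cvg => b.
by rewrite normrM ger0_norm ?tail_ge0 // ler_piMr ?tail_ge0.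
Qed.

Lemma fbar_series_cvg_lim : fbar_series dt W @ \oo -->
  (\matrix_(i, j) limn (series (fun b => tail p b * (W ^+ b) i j)) : 'M[R]_N).
Proof.
apply/cvg_mxP => i j; under eq_cvg do rewrite fbar_series_entry.
rewrite mxE; apply: tailM_series_cvg; exact: entry_norm.
Qed.

Lemma limit_propagatorE i j : limit_propagator dt W Rel i j =
  mu^-1 * limn (series (fun b => tail p b * relocated_mass j b)).
Proof.
rewrite /limit_propagator /fbar (cvg_lim (@norm_hausdorff _ _) fbar_series_cvg_lim).
rewrite -scalemxAr mxE; congr (_ * _).
rewrite mxE; apply/esym/cvg_lim => //.
under [X in _ --> X]eq_bigr do rewrite !mxE.
have -> : series (fun b => tail p b * relocated_mass j b) =
    (fun n => \sum_l rho l * series (fun b => tail p b * (W ^+ b) l j) n).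
  apply/funext => n; rewrite /series /=.
  under [RHS]eq_bigr do rewrite mulr_sumr.
  rewrite exchange_big /=; apply: eq_bigr => b _.
  rewrite /relocated_mass mulr_sumr; apply: eq_bigr => l _; ring.
apply: cvg_sum => l; apply: cvgM; first exact: cvg_cst.
by apply: tailM_series_cvg; exact: entry_norm.
Qed.

Lemma propagator_cvg_finite_mean : aperiodic (dt 0%N) ->
  propagator dt W Rel t @[t --> \oo] --> limit_propagator dt W Rel.
Proof.
move=> aper; apply/cvg_mxP => i j; apply/propagator_convol_cvg.
rewrite limit_propagatorE.
apply: (renewal_convol_cvg p_ge0 p0 p_sum _ _ (relocated_mass_norm j) aper tail_series_cvg).
  exact: renewal_mass_ge0.
exact: renewal_mass_eq.
Qed.

Lemma propagator_limit_unique (L : 'M[R]_N) :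
  propagator dt W Rel t @[t --> \oo] --> L -> L = limit_propagator dt W Rel.
Proof.
move=> /cvg_mxP PL; apply/matrixP => i j; rewrite limit_propagatorE.
have /propagator_convol_cvg H := PL i j.
exact: (renewal_convol_limit p_ge0 p0 p_sum (renewal_mass_eq dt_ge1)
  tail_series_cvg H).
Qed.

(** For each [b] the relocated masses sum to 1 over [j], so the series add up to that of the tail,
    which is [mu]. *)
Lemma limit_propagator_sum i : \sum_j limit_propagator dt W Rel i j = 1.
Proof.
have [r0 r1] := rho_distr.
under eq_bigr do rewrite limit_propagatorE.
rewrite -mulr_sumr.
have : \sum_j series (fun b => tail p b * relocated_mass j b) n @[n --> \oo] -->
    \sum_j limn (series (fun b => tail p b * relocated_mass j b)).
  by apply: cvg_sum => j; apply: tailM_series_cvg; exact: relocated_mass_norm.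
have -> : (fun n => \sum_j series (fun b => tail p b * relocated_mass j b) n) = series (tail p).
  apply/funext => n; rewrite /series /= exchange_big /=; apply: eq_bigr => b _.
  rewrite -mulr_sumr /relocated_mass exchange_big /=.
  by under eq_bigr do rewrite -mulr_sumr (Wb b).2 mulr1; rewrite r1 mulr1.
move=> /(cvg_unique (@Rhausdorff R) tail_series_cvg) <-.
by rewrite mulVf // gt_eqF // (lt_le_trans ltr01) // mean_ge1.
Qed.

(** This factorization yields the identical rows, the rank and, through [char_poly_rank1], the
    eigenvalues. *)
Lemma limit_propagator_rank1 (N0 : (0 < N)%N) : limit_propagator dt W Rel =
  (const_mx 1 : 'cV_N) *m row (Ordinal N0) (limit_propagator dt W Rel).
Proof.
apply/matrixP => i j; rewrite [RHS]mxE big_ord1 [X in X * _]mxE mul1r [RHS]mxE.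
by rewrite !limit_propagatorE.
Qed.

Lemma relocation_limit_propagator :
  limit_propagator dt W Rel = Rel *m limit_propagator dt W Rel.
Proof.
have [r0 r1] := rho_distr.
rewrite /limit_propagator mulmxA; congr (_ *m _); apply/matrixP => i j.
rewrite !mxE; under eq_bigr do rewrite !mxE.
by rewrite -mulr_suml r1 mul1r.
Qed.

End FiniteMean.

Lemma propagator_cvg_infinite_mean i j (l : R) :
  mean_time (dt 0%N) = +oo%E -> relocated_mass j @ \oo --> l ->
  propagator dt W Rel t i j @[t --> \oo] --> l.
Proof.
move=> muoo yl; apply/propagator_convol_cvg.
apply: (renewal_null_convol_cvg p_ge0 p0 p_sum) => //.
- exact: renewal_mass_ge0.
- exact: renewal_mass_eq.
- apply: nneseries_infty_unbounded; first exact: tail_ge0.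
  by rewrite -mean_timeE.
Qed.

End Propagator.

(** Expanding the powers in eigenprojections leaves the scalar series of [tail p b * lam m ^+ b]. At
    index 0 it sums to [mu] and the projection is the equilibrium; at the others [gen_fun_tail]
    applies, and [eigenvalue_neq1] permits the division. *)
Lemma limit_propagator_spectral (R : realType) (N : nat) (e : rel 'I_N)
    (e_simple : simple_graph e) (e_conn : connected_graph e)
    (e_nonbip : ~ bipartite_graph e)
    (rho : 'I_N -> R) (rho_distr : distribution_vector rho)
    (d : measure_display) (Omega : measurableType d) (P : probability Omega R)
    (dt : nat -> {RV P >-> nat})
    (dt_ge1 : forall n w, (1 <= dt n w)%N)
    (lam : 'I_N -> R) (phi phibar : 'M[R]_N) i j :
  (mean_time (dt 0%N) < +oo)%E -> eigensystem (transition_mx R e) lam phi phibar ->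
  limit_propagator dt (transition_mx R e) (relocation_mx rho) i j =
    degree R e j / \sum_r degree R e r + (fine (mean_time (dt 0%N)))^-1 *
      \sum_(m < N | (0 < m)%N) (1 - gen_fun (dt 0%N) (lam m)) / (1 - lam m) *
        \sum_r rho r * phi r m * phibar m j.
Proof.
move=> mu_fin es.
have sW : stochastic (transition_mx R e) := transition_stochastic R e_conn e_nonbip.
pose i0 := Ordinal (dim_gt0 e_nonbip).
rewrite (limit_propagatorE sW rho mu_fin).
set mu := fine _.
pose p := law (dt 0%N).
pose c m := \sum_r rho r * phi r m * phibar m j.
have yE b : relocated_mass (transition_mx R e) rho j b = \sum_m lam m ^+ b * c m.
  rewrite /relocated_mass (eq_bigr (fun l => \sum_m lam m ^+ b * (rho l * phi l m * phibar m j))).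
    by rewrite exchange_big /=; apply: eq_bigr => m _; rewrite mulr_sumr.
  move=> l _; rewrite (spectral_decomposition es) mulr_sumr.
  by apply: eq_bigr => m _; ring.
have lamb m b : `|lam m ^+ b| <= 1.
  by rewrite normrX exprn_ile1 // (eigenvalue_le1 e_conn e_nonbip es).
have Scvg m : cvgn (series (fun b => tail p b * lam m ^+ b)).
  exact: (tailM_series_cvg mu_fin (lamb m)).
have -> : limn (series (fun b => tail p b * relocated_mass (transition_mx R e) rho j b)) =
    \sum_m limn (series (fun b => tail p b * lam m ^+ b)) * c m.
  apply: cvg_lim => //.
  have -> : series (fun b => tail p b * relocated_mass (transition_mx R e) rho j b) =
      (fun n => \sum_m series (fun b => tail p b * lam m ^+ b) n * c m).
    apply/funext => n; rewrite /series /=.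
    under [RHS]eq_bigr do rewrite mulr_suml.
    rewrite exchange_big /=; apply: eq_bigr => b _.
    by rewrite yE mulr_sumr; apply: eq_bigr => m _; rewrite mulrA.
  by apply: cvg_sum => m; apply: cvgM; [exact: Scvg | exact: cvg_cst].
have mu0 : mu != 0.
  by rewrite gt_eqF // (lt_le_trans ltr01) // (mean_ge1 dt_ge1 mu_fin).
rewrite (bigD1 i0) //= mulrDr; congr (_ + _ * _).
  rewrite (_ : limn _ = mu); last first.
    apply: cvg_lim => //.
    have -> : (fun b => tail p b * lam i0 ^+ b) = tail p.
      by apply/funext => b; rewrite (lam0 e_nonbip es) expr1n mulr1.
    exact: (tail_series_cvg mu_fin).
  rewrite mulrA mulVf // mul1r /c.
  rewrite (eq_bigr (fun r => rho r * equilibrium_row R e 0 j)).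
    by rewrite -mulr_suml rho_distr.2 mul1r mxE.
  by move=> r _; rewrite -mulrA (eigenprojection0 e_simple e_conn e_nonbip es).
apply: eq_big => [m|m m0]; first by rewrite -val_eqE /= lt0n.
congr (_ * _).
have l1 : 1 - lam m != 0.
  rewrite subr_eq0 eq_sym (eigenvalue_neq1 e_simple e_conn e_nonbip es) //.
  by rewrite lt0n; rewrite -val_eqE in m0.
rewrite gen_fun_tail ?(eigenvalue_le1 e_conn e_nonbip es) //.
  by rewrite mulrAC mulfV // mul1r.
exact: law0.
Qed.

Theorem mainTheorem2 (R : realType) (N : nat) (e : rel 'I_N)
    (e_simple : simple_graph e) (e_conn : connected_graph e)
    (e_nonbip : ~ bipartite_graph e)
    (rho : 'I_N -> R) (rho_distr : distribution_vector rho)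
    (d : measure_display) (Omega : measurableType d) (P : probability Omega R)
    (dt : nat -> {RV P >-> nat})
    (dt_ge1 : forall n w, (1 <= dt n w)%N)
    (dt_indep : mutually_independent dt)
    (dt_id : identically_distributed dt) :
  let W := transition_mx R e in
  let Rel := relocation_mx rho in
  let Pt := propagator dt W Rel in
  let Pinf := limit_propagator dt W Rel in
  let mu := mean_time (dt 0%N) in
  [/\ (mu < +oo)%E ->
        [/\ cvgn (fbar_series dt W),
            aperiodic (dt 0%N) -> Pt t @[t --> \oo] --> Pinf,
            forall L : 'M[R]_N, Pt t @[t --> \oo] --> L -> L = Pinf,
            forall (lam : 'I_N -> R) (phi phibar : 'M[R]_N),
              eigensystem W lam phi phibar ->
              forall i j : 'I_N,
                Pinf i j = degree R e j / \sum_r degree R e r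
                  + (fine mu)^-1 *
                    \sum_(m < N | (0 < m)%N)
                      (1 - gen_fun (dt 0%N) (lam m)) / (1 - lam m) *
                      \sum_r rho r * phi r m * phibar m j &
            [/\ forall i i' j : 'I_N, Pinf i j = Pinf i' j,
                forall i : 'I_N, \sum_j Pinf i j = 1,
                Pinf = Rel *m Pinf,
                \rank Pinf = 1%N &
                char_poly Pinf =
                  \prod_(a <- 1 :: nseq N.-1 0) ('X - a%:P)]],
      mu = +oo%E ->
        forall i j : 'I_N,
          Pt t i j @[t --> \oo] --> degree R e j / \sum_r degree R e r &
      forall L : 'M[R]_N, Pt t @[t --> \oo] --> L ->
        L <> equilibrium_mx R e -> (mu < +oo)%E].
Proof.
move=> W Rel Pt Pinf mu.
have sW : stochastic W := transition_stochastic R e_conn e_nonbip.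
have N0 := dim_gt0 e_nonbip.
have infinite : mu = +oo%E -> forall i j : 'I_N,
    Pt t i j @[t --> \oo] --> degree R e j / \sum_r degree R e r.
  move=> muoo i j.
  apply: (propagator_cvg_infinite_mean dt_ge1 dt_indep dt_id sW rho_distr i muoo).
  exact: relocated_mass_cvg.
split => //; last first.
  (* By contraposition: with an infinite mean, uniqueness of limits makes [L] the equilibrium. *)
  move=> L /cvg_mxP PL Lneq; rewrite ltey; apply/eqP => muoo; apply: Lneq.
  apply/matrixP => i j; rewrite mxE.
  exact: (cvg_unique (@Rhausdorff R) (PL i j) (infinite muoo i j)).
move=> mu_fin.
have rk1 := limit_propagator_rank1 sW rho mu_fin N0.
have sum1 := limit_propagator_sum dt_ge1 sW rho_distr mu_fin.
split.
- by apply/cvg_ex; eexists; exact: (fbar_series_cvg_lim sW mu_fin).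
- exact: (propagator_cvg_finite_mean dt_ge1 dt_indep dt_id sW rho_distr mu_fin).
- exact: (propagator_limit_unique dt_ge1 dt_indep dt_id sW rho_distr mu_fin).
- by move=> lam phi phibar es i j; exact: limit_propagator_spectral.
split => //.
- by move=> i i' j; rewrite /Pinf rk1 !mxE !big_ord1 !mxE.
- exact: relocation_limit_propagator.
(* The factorization bounds the rank by 1; the matrix is not zero because its rows sum to 1. *)
- apply/eqP; rewrite eqn_leq lt0n mxrank_eq0; apply/andP; split.
    by rewrite /Pinf rk1; exact: mulmx_max_rank.
  apply/eqP => P0; have := sum1 (Ordinal N0); rewrite -/Pinf P0 big1 => [|k _].
    by move/eqP; rewrite eq_sym oner_eq0.
  by rewrite mxE.
(* The one possibly nonzero root is the row times the column of ones, that is the row sum 1. *)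
- rewrite /Pinf rk1 char_poly_rank1 // big_cons big_nseq iter_mulr_1 subr0 mulrC.
  congr (('X - _%:P) * _).
  rewrite mxE -[RHS](sum1 (Ordinal N0)); apply: eq_bigr => k _.
  by rewrite [X in _ * X]mxE mulr1 mxE.
Qed.
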